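(* Let $G$ be a forest and $H$ be a graph. Suppose that $G$ has no vertex $u$ such that $uv\in E(G)$ for any (that is, every) $v\in V(G)\setminus\{u\}$, and that $|I(H)|$ is homotopy equivalent to a wedge sum of spheres. Then $|I(G[H])|$ is homotopy equivalent to a wedge sum of spheres.
   Context: Graphs are finite, undirected, without loops or multiple edges; $V(G)$ and $E(G)$ are the vertex and edge sets, and $uv$ denotes the edge $\{u,v\}$. A forest is a graph containing no cycle $C_n$ on $n$ vertices ($n\ge 3$) as a full (induced) subgraph. The independence complex $I(G)$ is the abstract simplicial complex $\{\sigma\subset V(G): uv\notin E(G)\text{ for any }u,v\in\sigma\}$, and $|\cdot|$ denotes geometric realization. The lexicographic product $G[H]$ is the graph with vertex set $V(G)\times V(H)$ in which $(u_1,v_1)$ and $(u_2,v_2)$ are adjacent iff either $u_1u_2\in E(G)$, or $u_1=u_2$ and $v_1v_2\in E(H)$. A wedge sum of spheres is a wedge of spheres $S^d$ (not necessarily of the same dimension), where $S^d$ is the $d$-dimensional sphere. $\bigvee_n X$ denotes the wedge of $n$ copies of $X$, with $\bigvee_0 X$ the one-point space. $0$-spheres are handled by the convention that $\bigvee_n S^0$ is the discrete space with $n+1$ points and $X\vee(\bigvee_n S^0)$ is the disjoint union of $X$ and $n$ points. *)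

(* Defs.v *)
From HB Require Import structures.
From mathcomp Require Import all_boot all_order all_algebra.
From mathcomp Require Import all_classical reals topology normedtype homotopy.
Import Order.TTheory GRing.Theory Num.Theory.
Import numFieldNormedType.Exports.

Set Implicit Arguments.
Unset Strict Implicit.
Unset Printing Implicit Defensive.

Local Open Scope classical_set_scope.
Local Open Scope ring_scope.

Record graph := Graph {
  vertex :> finType;
  adj : rel vertex;
  adj_sym : symmetric adj;
  adj_irr : irreflexive adj
}.

Definition lex_adj (G H : graph) : rel (G * H) :=
  fun p q => adj p.1 q.1 || (p.1 == q.1) && adj p.2 q.2.

Lemma lex_adj_sym (G H : graph) : symmetric (@lex_adj G H).
Proof.
by move=> p q; rewrite /lex_adj (adj_sym p.1) (adj_sym p.2) (eq_sym p.1).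
Qed.

Lemma lex_adj_irr (G H : graph) : irreflexive (@lex_adj G H).
Proof. by move=> p; rewrite /lex_adj !adj_irr andbF. Qed.

Definition lex_product (G H : graph) : graph :=
  Graph (@lex_adj_sym G H) (@lex_adj_irr G H).

(* [ordS] is the successor modulo n.+3, so this is the cycle on n.+3 >= 3
   vertices. *)
Definition cycle_adj (n : nat) : rel 'I_n.+3 :=
  fun i j => (j == ordS i) || (i == ordS j).

Lemma cycle_adj_sym (n : nat) : symmetric (@cycle_adj n).
Proof. by move=> i j; rewrite /cycle_adj orbC. Qed.

Lemma cycle_adj_irr (n : nat) : irreflexive (@cycle_adj n).
Proof.
move=> i; rewrite /cycle_adj orbb; apply/negP => /eqP /(congr1 val) /=.
have [lt_in | le_ni] := ltnP i.+1 n.+3.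
  by rewrite modn_small // => /esym; apply/eqP; rewrite neq_ltn ltnSn orbT.
have -> : i.+1 = n.+3 by apply/eqP; rewrite eqn_leq le_ni ltn_ord.
by rewrite modnn => i0; move: le_ni; rewrite i0.
Qed.

Definition cycle_graph (n : nat) : graph :=
  Graph (@cycle_adj_sym n) (@cycle_adj_irr n).

Definition contains_full (G C : graph) : Prop :=
  exists f : C -> G, injective f /\ forall i j : C, adj (f i) (f j) = adj i j.

Definition forest (G : graph) : Prop :=
  forall n : nat, ~ contains_full G (cycle_graph n).

Definition indep_complex (G : graph) : {set {set G}} :=
  [set s : {set G} | [forall u in s, forall v in s, ~~ adj u v]].

(* The points of |K| in barycentric coordinates. As V is finite, the topology
   induced from R^V is the usual one. When K is {set0} this is the empty
   space. *)
Definition realization_set (R : realType) (V : finType) (K : {set {set V}}) :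
    set {ptws V -> R} :=
  [set x | [/\ forall v, 0 <= x v, \sum_v x v = 1 &
               [set v : V | x v != 0]%SET \in K]].

Definition realization (R : realType) (V : finType) (K : {set {set V}}) :
  topologicalType := set_type (@realization_set R V K).

Definition homotopic (R : realType) (X Y : topologicalType) (f g : X -> Y) :
    Prop :=
  exists h : R * X -> Y,
    [/\ {within `[0, 1]%classic `*` [set: X], continuous h},
        forall x, h (0, x) = f x & forall x, h (1, x) = g x].

Definition homotopy_equivalent (R : realType) (X Y : topologicalType) : Prop :=
  exists (f : X -> Y) (g : Y -> X),
    [/\ continuous f, continuous g,
        homotopic R (g \o f) idfun & homotopic R (f \o g) idfun].

Definition sphere_set (R : realType) (d : nat) : set 'rV[R]_d.+1 :=
  [set x | \sum_i x 0 i ^+ 2 = 1].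

Definition sphere (R : realType) (d : nat) : topologicalType :=
  set_type (@sphere_set R d).

Lemma sphere_pole_subproof (R : realType) (d : nat) :
  delta_mx 0 0 \in @sphere_set R d.
Proof.
apply/mem_set; rewrite /sphere_set /= (bigD1 0) //= big1 => [|i /negPf i0].
  by rewrite !mxE !eqxx expr1n addr0.
by rewrite !mxE i0 andbF expr0n.
Qed.

Definition sphere_pole (R : realType) (d : nat) : sphere R d :=
  exist _ (delta_mx 0 0) (sphere_pole_subproof R d).

Definition one_point (R : realType) : topologicalType :=
  set_type [set (0 : R)].

(* The library's [wedge] over an empty family is the empty space, hence the
   separate first case, where the wedge of no spheres is the one-point space.
   As S^0 is pointed, wedging X with S^0 adds one isolated point to X, so that
   no special treatment of 0-spheres is needed. *)
Definition he_wedge_of_spheres (R : realType) (X : topologicalType) : Prop :=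
  homotopy_equivalent R X (one_point R) \/
  exists (n : nat) (d : 'I_n.+1 -> nat),
    homotopy_equivalent R X (wedge (fun i => sphere_pole R (d i))).

(* Main.v *)
(* The complex I(G[H]) is a polyhedral join: its simplices lie over independent
   sets of G, with every fiber a simplex of I(H). Extending maps homogeneously in
   each fiber shows that its homotopy type depends only on that of |I(H)|, so that
   I(H) may be replaced by a standard complex N: boundaries of simplices glued at
   one vertex q. What remains is simple homotopy theory.

   Let Z(U) be the join over a vertex set U, let v be a leaf of G with neighbor w,
   and let L = Z(G - N[w]). Then Z(G) is the union of Z(G - w) and N_w * L, which
   meet in L, and L spans a cone in both (with tips q_v and q_w). Adding N_w * L
   amounts to attaching first q_w * L and then t * L for the simplices t of N_w
   whose union with q_w is not in N_w; all the other simplices come in pairs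
   differing by q_w, that is, are added by elementary expansions. Each set alpha * L
   so attached has its boundary in E * L for a collapsible complex E. This property
   is inherited when L is itself decomposed along a leaf, down to single cells
   attached along a subset of a collapsible complex; these add a wedge summand.
   Since w does not dominate G, L is nonempty, so that q_v and q_w lie in the same
   component, and all wedges can be taken at the same point. *)
From mathcomp Require Import all_boot.

Set Implicit Arguments.
Unset Strict Implicit.
Unset Printing Implicit Defensive.

(** * Simple homotopy equivalence *)

(** Since [L] need not be collapsible, [alpha * L] cannot be attached in one move; the obstacle is
    to know, for each simplex attached, that its boundary is contractible in what has been built so
    far. Hence the induction hypothesis [attachable] quantifies over the current complex, over
    [alpha] and over the collapsible complex [E]: one step replaces [alpha] by [alpha :|: tau], and
    [E] by a larger collapsible complex made of [E], [alpha], the faces of [tau] and a tip [q]. This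
    is where the shape of [N] matters: when [q |: tau] is missing, all [q |: c] with [c] proper in
    [tau] must be present, so that [q] cones off the boundary of [tau]. A complex may be void, that
    is, lack even the empty simplex. Collapsible complexes are built from the void one, where a cone
    arises in a single toggle that pairs the empty simplex with the tip; the same toggles can then
    be replayed under any simplex. Collapses keep topology out of the induction: continuous maps are
    needed only for one collapse, for renaming vertices, for the fiberwise extension, and for
    comparing standard complexes with wedges. *)

Definition complex (V : finType) (K : {set {set V}}) :=
  forall s t : {set V}, t \subset s -> s \in K -> t \in K.

(* Collapses never remove the base point, which makes the relation compatible
   with wedges at the base point. *)
Inductive simple_equiv : forall V W : finType,
    {set {set V}} -> V -> {set {set W}} -> W -> Prop :=
| simple_equiv_collapse (V : finType) (K : {set {set V}}) (p : V) (s : {set V}) (u : V) of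
    complex K & [set p] \in K & s != set0 & s != [set p] & u \notin s & u |: s \in K
    & (forall t, t \in K -> s \subset t -> t = s \/ t = u |: s) :
    simple_equiv K p (K :\ s :\ (u |: s)) p
| simple_equiv_rename (V W : finType) (f : V -> W) (K : {set {set V}}) (p : V) of
    injective f : simple_equiv K p [set f @: s | s : {set V} in K] (f p)
| simple_equiv_sym (V W : finType) (K : {set {set V}}) p (L : {set {set W}}) q of
    simple_equiv K p L q : simple_equiv L q K p
| simple_equiv_trans (V1 V2 V3 : finType) (K1 : {set {set V1}}) p1
    (K2 : {set {set V2}}) p2 (K3 : {set {set V3}}) p3 of
    simple_equiv K1 p1 K2 p2 & simple_equiv K2 p2 K3 p3 : simple_equiv K1 p1 K3 p3.

Lemma simple_equiv_refl (V : finType) (K : {set {set V}}) p : simple_equiv K p K p.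
Proof. by have h := simple_equiv_rename K p (@inj_id V); exact: simple_equiv_trans (simple_equiv_sym h). Qed.

Section Toggle.
Variable V : finType.
Implicit Types (A B C K : {set {set V}}) (s t : {set V}) (u p : V).

Lemma complex0 : complex (set0 : {set {set V}}).
Proof. by move=> s t _; rewrite inE. Qed.

(* [B] collapses to [A], by pairing [t] with [u |: t] outside [A]. *)
Definition toggle u A B :=
  [/\ complex A, complex B, A \subset B &
      forall t, t \in B -> t \notin A -> u |: t \in B /\ t :\ u \notin A].

(** A largest simplex [s] of [B] outside [A] without [u] is a free face: any simplex above it is
    outside [A], and deleting [u] leaves a simplex outside [A] that contains [s], hence equals [s].
    Removing the pair [s], [u |: s] preserves the toggle condition. *)
Lemma toggle_simple_equiv u A B p : toggle u A B -> [set p] \in A -> simple_equiv B p A p.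
Proof.
move=> tAB pA; have [n] := ubnP #|B :\: A|.
elim: n B tAB => // n IHn B [cA cB sAB tog] ltn.
have [/eqP|[s0]] := set_0Vmem (B :\: A).
  rewrite setD_eq0 => sBA; have -> : B = A by apply/eqP; rewrite eqEsubset sBA.
  exact: simple_equiv_refl.
rewrite inE => /andP[s0A s0B].
pose P s := [&& s \in B, s \notin A & u \notin s].
have P0 : P (s0 :\ u).
  rewrite /P setD11 andbT (cB s0) ?subD1set //=.
  by have [] := tog _ s0B s0A.
case: (@arg_maxnP _ _ P (fun s => #|s|) P0) => s /and3P[sB sA us] smax.
have [usB _] := tog _ sB sA.
have free t : t \in B -> s \subset t -> t = s \/ t = u |: s.
  move=> tB st; have tA : t \notin A by apply: contra sA; exact: cA.
  have [_ tuA] := tog _ tB tA.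
  have stu : s \subset t :\ u by rewrite subsetD1 st.
  have /eqP E : s == t :\ u.
    rewrite eqEcard stu /=; apply: smax.
    by rewrite /P (cB t) ?subD1set //= tuA setD11.
  have [ut|ut] := boolP (u \in t); first by right; rewrite E setD1K.
  left; rewrite E; apply/setP=> x; rewrite !inE.
  by case: eqVneq => // ->; rewrite (negbTE ut).
have s_neq0 : s != set0.
  by apply: contraNneq sA => ->; apply: cA pA; exact: sub0set.
have s_neqp : s != [set p] by apply: contraNneq sA => ->.
apply: simple_equiv_trans (simple_equiv_collapse cB (subsetP sAB _ pA) s_neq0 s_neqp us usB free) _.
have usA : u |: s \notin A by apply: contra sA; apply: cA; exact: subsetUr.
apply: IHn; last first.
  rewrite ltnS in ltn; apply: (leq_trans _ ltn); apply: proper_card; apply/properP; split.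
    by apply/subsetP=> t; rewrite !inE => /and3P[-> _ /andP[_ ->]].
  by exists s; rewrite !inE ?sA ?sB // eqxx andbF.
split=> //.
- move=> r t tr; rewrite !inE => /and3P[r1 r2 rB]; rewrite (cB _ _ tr rB) andbT.
  apply/andP; split; apply/negP => /eqP tE; subst t.
    by case: (free _ rB) => [|/eqP|/eqP]; rewrite ?(negbTE r1) ?(negbTE r2) //;
      apply: subset_trans tr; exact: subsetUr.
  by case: (free _ rB tr) => /eqP; rewrite ?(negbTE r1) ?(negbTE r2).
- apply/subsetP=> t tA; rewrite !inE (subsetP sAB) // andbT.
  by apply/andP; split; apply: contraTneq tA => ->.
move=> t; rewrite !inE => /and3P[t1 t2 tB] tA; have [utB tuA] := tog _ tB tA.
split=> //; rewrite utB andbT; apply/andP; split; apply/negP => /eqP E.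
  have su : s = t :\ u.
    apply/setP=> x; move/setP/(_ x): E; rewrite !inE.
    by case: eqVneq => //= ->; rewrite (negbTE us).
  have [ut|ut] := boolP (u \in t); first by move: t1; rewrite su setD1K ?eqxx.
  move: t2; rewrite su; move/eqP; case; apply/setP=> x; rewrite !inE.
  by case: eqVneq => // ->; rewrite (negbTE ut).
by move: us; rewrite -E setU11.
Qed.

(* In particular [texp set0 E] says that [E] is void or collapsible. *)
Inductive texp A : {set {set V}} -> Prop :=
| texp_refl of complex A : texp A A
| texp_step B C u of texp A B & toggle u B C : texp A C.

Lemma texp_complex A B : texp A B -> complex A /\ complex B.
Proof. by elim=> // {}B C u _ [cA _] []. Qed.

Lemma texp_sub A B : texp A B -> A \subset B.
Proof. by elim=> // {}B C u _ AB [_ _ BC _]; exact: subset_trans BC. Qed.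

Lemma texp_trans A B C : texp A B -> texp B C -> texp A C.
Proof. by move=> AB; elim=> // B1 C1 u _ AB1 t; exact: (texp_step AB1 t). Qed.

Lemma texp_toggle u A B : toggle u A B -> texp A B.
Proof. by move=> t; apply: (texp_step (texp_refl _) t); case: t. Qed.

Lemma texp_simple_equiv A B p : texp A B -> [set p] \in A -> simple_equiv B p A p.
Proof.
move=> AB pA; elim: AB => [_|{}B C u AB IH t]; first exact: simple_equiv_refl.
apply: simple_equiv_trans IH; apply: (toggle_simple_equiv t).
exact: (subsetP (texp_sub AB)).
Qed.

Lemma complex_join A E (c : {set V}) : complex A -> complex E ->
  (forall c' e : {set V}, c' \proper c -> e \in E -> c' :|: e \in A) ->
  complex (A :|: [set c :|: e | e : {set V} in E]).
Proof.
move=> cA cE sub s t ts; rewrite !inE => /orP[sA|/imsetP[e eE sE]].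
  by rewrite (cA _ _ ts sA).
have tE : t = (t :&: c) :|: (t :&: e).
  by rewrite -setIUr -sE; apply/esym/setIidPl.
have teE : t :&: e \in E by apply: cE eE; exact: subsetIr.
have [tc|] := boolP (t :&: c == c).
  by apply/orP; right; apply/imsetP; exists (t :&: e); rewrite // {1}tE (eqP tc).
rewrite eqEproper => /nandP[|]; first by rewrite subsetIr.
by rewrite negbK => /sub h; apply/orP; left; rewrite tE; exact: h.
Qed.

(** The toggles that build [E] are replayed under [c]. As they start from the void complex, [c]
    itself gets paired too, namely with the first apex added to it. *)
Lemma texp_join A E (c : {set V}) : texp set0 E -> complex A ->
  (forall c' e : {set V}, c' \proper c -> e \in E -> c' :|: e \in A) ->
  (forall e, e \in E -> [disjoint c & e] /\ c :|: e \notin A) ->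
  texp A (A :|: [set c :|: e | e : {set V} in E]).
Proof.
move=> tE cA; elim: tE => [_ _ _|B C u tB IH tBC sub dis].
  by rewrite imset0 setU0; exact: texp_refl.
have [cB cC sBC tog] := tBC.
have cj D : complex D -> D \subset C ->
    complex (A :|: [set c :|: e | e : {set V} in D]).
  by move=> cD sDC; apply: complex_join => // c' e c'c /(subsetP sDC); exact: sub.
apply: texp_step (_ : toggle u _ _).
  apply: IH => [c' e pc eB|e eB]; first by apply: sub; rewrite ?(subsetP sBC).
  by apply: dis; exact: (subsetP sBC).
split.
- exact: cj.
- exact: cj.
- by apply: setUS; apply: imsetS.
move=> t; rewrite !inE => /orP[-> //|/imsetP[e eC ->]] /norP[cA' ceB].
have eB : e \notin B by apply: contra ceB => eB; apply/imsetP; exists e.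
have [ueC euB] := tog _ eC eB.
have uc : u \notin c.
  have [d _] := dis _ ueC; apply/negP=> uc.
  by have := disjointFr d uc; rewrite setU11.
have euC : e :\ u \in C by apply: cC eC; exact: subD1set.
have -> : (c :|: e) :\ u = c :|: (e :\ u).
  rewrite setDUl; congr (_ :|: _); apply/setP=> x; rewrite !inE.
  by case: eqVneq => // ->; rewrite (negbTE uc).
split.
  apply/orP; right; apply/imsetP; exists (u |: e) => //.
  by rewrite setUCA.
apply/norP; split; first by have [] := dis _ euC.
apply: contra euB => /imsetP[e' e'B eqE].
suff -> : e :\ u = e' by [].
have [d _] := dis _ euC; have [d' _] := dis _ (subsetP sBC _ e'B).
apply/setP=> x; move/setP/(_ x): eqE; rewrite in_setU [in X in _ = X -> _]in_setU.
have [xc|//] := boolP (x \in c).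
by rewrite (disjointFr d xc) (disjointFr d' xc).
Qed.

End Toggle.

(** * Wedges of boundaries of simplices *)

Lemma mem_imset_complex (V W : finType) (f : V -> W) (K : {set {set V}}) t :
  injective f ->
  (t \in [set f @: s | s : {set V} in K]) =
  (t \subset f @: [set: V]) && (f @^-1: t \in K).
Proof.
move=> f_inj; apply/imsetP/andP => [[s sK ->]|[st tK]].
  split; first by apply: imsetS; exact: subsetT.
  rewrite (_ : _ @^-1: _ = s) //.
  by apply/setP=> x; rewrite inE mem_imset.
exists (f @^-1: t) => //; apply/setP=> y; apply/idP/imsetP => [yt|[x]].
  have /imsetP[x _ yE] := subsetP st _ yt.
  by exists x => //; rewrite inE -yE.
by rewrite inE => xt ->.
Qed.

Section Sum.
Variables V U : finType.
Implicit Types (t : {set V + U}) (s : {set V}).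

Definition setl t : {set V} := inl @^-1: t.
Definition setr t : {set U} := inr @^-1: t.

Lemma setlS t t' : t \subset t' -> setl t \subset setl t'.
Proof. exact: preimsetS. Qed.

Lemma setrS t t' : t \subset t' -> setr t \subset setr t'.
Proof. exact: preimsetS. Qed.

Lemma inl_imsetE t s : (t == inl @: s) = (setr t == set0) && (setl t == s).
Proof.
have inl_inj : injective (@inl V U) by move=> ? ? [].
apply/eqP/andP => [->|[/eqP r0 /eqP <-]].
  split; apply/eqP/setP=> x; rewrite !inE ?mem_imset //.
  by apply/imsetP=> -[].
apply/setP=> -[x|x]; first by rewrite mem_imset // inE.
transitivity false; first by move/setP/(_ x): r0; rewrite !inE.
by apply/esym/imsetP=> -[].
Qed.

Lemma setl_imset s : setl (inl @: s) = s.
Proof. by have := inl_imsetE (inl @: s) s; rewrite eqxx => /esym/andP[_ /eqP]. Qed.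

Lemma setr_imset s : setr (inl @: s) = set0.
Proof. by have := inl_imsetE (inl @: s) s; rewrite eqxx => /esym/andP[/eqP]. Qed.

(* The wedge of [K] and the boundary of the simplex with vertices [p] and [U]. *)
Definition add_sphere (K : {set {set V}}) (p : V) : {set {set V + U}} :=
  [set t | if setr t == set0 then setl t \in K
           else (setl t \subset [set p]) && ((setr t != setT) || (setl t == set0))].

Lemma complex_add_sphere K p : complex K -> [set p] \in K -> complex (add_sphere K p).
Proof.
move=> cK pK s t ts; have sl := setlS ts; have sr := setrS ts; rewrite !inE.
have [s0|s0] := eqVneq (setr s) set0.
  by rewrite s0 subset0 in sr; rewrite sr; exact: cK.
have [t0|t0] := eqVneq (setr t) set0.
  by move=> /andP[sp _]; apply: cK pK; exact: subset_trans sp.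
move=> /andP[sp h]; rewrite (subset_trans sl sp) /=.
case/orP: h => [h|/eqP h]; last by rewrite h subset0 in sl; rewrite sl orbT.
by apply/orP; left; apply: contraNneq h => h; rewrite -subTset -h.
Qed.

End Sum.

(** The base point conditions on collapses serve here: a simplex of the added sphere meets [K]
    inside [[set p]], so it cannot contain [s], which is neither empty nor [[set p]], and [s]
    remains free. *)
Lemma simple_equiv_add_sphere (U V W : finType) (K : {set {set V}}) p (L : {set {set W}}) q :
  simple_equiv K p L q -> simple_equiv (add_sphere U K p) (inl p) (add_sphere U L q) (inl q).
Proof.
elim=> {V W K p L q}
  [V K p s u cK pK s0 sp us usK free|V W f K p f_inj|V W K p L q _|
   V1 V2 V3 K1 p1 K2 p2 K3 p3 _ h1 _]; last 2 first.
- exact: simple_equiv_sym.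
- exact: simple_equiv_trans h1.
- have uE : (inl u : V + U) |: inl @: s = inl @: (u |: s) by rewrite imsetU1.
  have -> : add_sphere U (K :\ s :\ (u |: s)) p =
      add_sphere U K p :\ inl @: s :\ (inl u |: inl @: s).
    apply/setP=> t; rewrite uE !in_setD1 !inl_imsetE !inE; by case: eqP.
  apply: simple_equiv_collapse.
  + exact: complex_add_sphere.
  + have -> : [set inl p] = (inl : V -> V + U) @: [set p] by rewrite imset_set1.
    by rewrite inE setr_imset eqxx setl_imset.
  + apply: contraNneq s0 => E; have := congr1 (@setl V U) E; rewrite setl_imset => ->.
    by apply/eqP/setP=> x; rewrite !inE.
  + apply: contraNneq sp => E; have := congr1 (@setl V U) E; rewrite setl_imset => ->.
    by apply/eqP/setP=> x; rewrite !inE.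
  + by rewrite mem_imset // => x y [].
  + by rewrite uE inE setr_imset eqxx setl_imset.
  + move=> t; rewrite inE => tK st.
    have sl := setlS st; rewrite setl_imset in sl.
    have [r0|r0] := eqVneq (setr t) set0.
      rewrite r0 eqxx in tK.
      by case: (free _ tK sl) => tE; [left|right; rewrite uE];
        apply/eqP; rewrite inl_imsetE r0 tE !eqxx.
    move: tK; rewrite (negbTE r0) => /andP[/(subset_trans sl)].
    by rewrite subset1 (negbTE sp) (negbTE s0).
- pose F (x : V + U) : W + U := match x with inl v => inl (f v) | inr j => inr j end.
  have F_inj : injective F by move=> [x|x] [y|y] //= [] => [/f_inj|] ->.
  suff -> : add_sphere U [set f @: s | s : {set V} in K] (f p) =
      [set F @: s | s : {set V + U} in add_sphere U K p].
    exact: (simple_equiv_rename _ _ F_inj).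
  apply/setP=> t; rewrite mem_imset_complex // !inE mem_imset_complex //.
  have -> : setl (F @^-1: t) = f @^-1: (setl t) by apply/setP=> x; rewrite !inE.
  have -> : setr (F @^-1: t) = setr t by apply/setP=> x; rewrite !inE.
  have -> : (t \subset F @: setT) = (setl t \subset f @: setT).
    apply/subsetP/subsetP=> h x.
      by rewrite inE => /h/imsetP[[y|y] _ //= [->]]; exact: imset_f.
    case: x => [x|x] xt; last by apply/imsetP; exists (inr x).
    have /h/imsetP[y _ ->] : x \in setl t by rewrite inE.
    by apply/imsetP; exists (inl y).
  case: ifP => // _; move: (setl t) => a; apply/andP/idP => [[ap h]|/and3P[af ap h]].
    have af : a \subset f @: setT.
      by apply: subset_trans ap _; rewrite sub1set imset_f.
    rewrite af /=; apply/andP; split.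
      by apply/subsetP=> x; have := subsetP ap (f x); rewrite !inE (inj_eq f_inj).
    case/orP: h => [->//|/eqP ->]; rewrite orbC; apply/orP; left.
    by apply/eqP/setP=> x; rewrite !inE.
  have aE x : x \in a -> exists2 y, x = f y & y \in f @^-1: a.
    by move=> xa; have /imsetP[y _ xE] := subsetP af _ xa; exists y; rewrite // inE -xE.
  split.
    by apply/subsetP=> x /aE[y -> /(subsetP ap)]; rewrite !inE => /eqP ->.
  case/orP: h => [->//|/eqP h]; rewrite orbC; apply/orP; left.
  by apply/eqP/setP=> x; rewrite inE; apply/negP=> /aE[y _]; rewrite h inE.
Qed.

Section Std.
Variables (I : finType) (d : I -> nat).
(** Each lobe has [d i] + 1 vertices of its own besides the common vertex [None], so that its
    boundary is a sphere of dimension [d i]. *)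
Definition std_vertex : finType := option {i : I & 'I_(d i).+1}.
Definition lobe (i : I) : {set std_vertex} :=
  [set x | if x is Some y then tag y == i else true].
(* The wedge at [None] of the boundaries of the simplices [lobe i], of
   dimensions [d i]. *)
Definition std : {set {set std_vertex}} :=
  [set s : {set std_vertex} | (s \subset [set None]) || [exists i, s \proper lobe i]].

Lemma complex_std : complex std.
Proof.
move=> s t ts; rewrite !inE => /orP[h|/existsP[i h]].
  by rewrite (subset_trans ts h).
by apply/orP; right; apply/existsP; exists i; exact: sub_proper_trans h.
Qed.

(** Such a [t] is the facet of a lobe opposite to [None]. Apart from being a complex that contains
    its base vertex, this is all that the attaching argument requires of the fibers. *)
Lemma std_apex (t : {set std_vertex}) :
  t \in std -> None |: t \notin std ->
  forall c : {set std_vertex}, c \proper t -> None |: c \in std.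
Proof.
rewrite !inE subUset subxx /= => /orP[->//|/existsP[i ti]] /norP[tN ht] c ct.
rewrite inE; apply/orP; right; apply/existsP; exists i.
have ti' : None |: t \subset lobe i.
  by rewrite subUset (proper_sub ti) sub1set inE.
apply: proper_sub_trans ti'; apply/properP; split; first exact/setUS/proper_sub.
have [_ [x xt xc]] := properP ct.
have [xN|xN] := eqVneq x None; last by exists x; rewrite !inE ?xt ?orbT // (negbTE xN).
have : None |: t = t by apply/setUidPr; rewrite sub1set -xN.
by move=> tE; move: ht; rewrite tE => /existsP[]; exists i.
Qed.

End Std.

Definition wedgelike (V : finType) (K : {set {set V}}) (p : V) :=
  exists (I : finType) (d : I -> nat), simple_equiv K p (std d) None.

Lemma wedgelike_simple_equiv (V W : finType) (K : {set {set V}}) p (L : {set {set W}}) q :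
  simple_equiv K p L q -> wedgelike K p -> wedgelike L q.
Proof. by move=> KL [I [d Kd]]; exists I, d; apply: simple_equiv_trans Kd; exact: simple_equiv_sym. Qed.

(** The added sphere becomes the lobe of the new index [None] of [option I]; the maps [g] and [h]
    translate between the two numberings of the vertices. *)
Lemma wedgelike_add_sphere (V : finType) (K : {set {set V}}) p m :
  wedgelike K p -> wedgelike (add_sphere 'I_m.+1 K p) (inl p).
Proof.
move=> [I [d Kd]].
pose d' (o : option I) := if o is Some i then d i else m.
exists (option I), d'; apply: simple_equiv_trans (simple_equiv_add_sphere _ Kd) _.
pose g (x : std_vertex d + 'I_m.+1) : std_vertex d' :=
  match x with
  | inl None => None
  | inl (Some y) => Some (@Tagged _ (Some (tag y)) (fun o => 'I_(d' o).+1) (tagged y))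
  | inr j => Some (@Tagged _ None (fun o => 'I_(d' o).+1) j)
  end.
pose h (x : std_vertex d') : std_vertex d + 'I_m.+1 :=
  match x with
  | None => inl None
  | Some (existT o j) =>
    match o return 'I_(d' o).+1 -> (std_vertex d + 'I_m.+1)%type with
    | Some i => fun j => inl (Some (@Tagged _ i (fun i => 'I_(d i).+1) j))
    | None => fun j => inr j end j
  end.
have gK : cancel g h by move=> [[[i j]|]|j].
have hK : cancel h g by move=> [[[i|] j]|].
suff -> : std d' = [set g @: s | s : {set _} in add_sphere 'I_m.+1 (std d) None].
  exact: (simple_equiv_rename _ (inl None) (can_inj gK)).
apply/setP=> t; rewrite mem_imset_complex; last exact: can_inj gK.
have -> /= : t \subset g @: setT.
  by apply/subsetP=> x _; apply/imsetP; exists (h x).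
have lE x : (x \in setl (g @^-1: t)) = (g (inl x) \in t) by rewrite !inE.
have rE x : (x \in setr (g @^-1: t)) = (g (inr x) \in t) by rewrite !inE.
rewrite [in LHS]inE [in RHS]inE.
have [r0|r0] := eqVneq (setr _) set0.
  have tN j : Some (@Tagged _ None (fun o => 'I_(d' o).+1) j) \notin t.
    by have := rE j; rewrite r0 inE /= => <-.
  rewrite [in RHS]inE; apply/orP/orP => -[H|/existsP[i H]].
  - left; apply/subsetP=> -[y|]; by rewrite lE /= => /(subsetP H); rewrite !inE.
  - case: i H => [i|] H.
      right; apply/existsP; exists i; have [/subsetP H1 [x xi xt]] := properP H.
      apply/properP; split.
        apply/subsetP=> -[y|]; rewrite lE ?inE //= => /H1.
        by rewrite inE /= => /eqP[<-].
      case: x xi xt => [[[i'|] j]|]; rewrite !inE //=.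
        move=> /eqP[E]; subst i' => xt; exists (Some (@Tagged _ i (fun i => 'I_(d i).+1) j)).
          by rewrite inE.
        by rewrite lE.
      by move=> _ xt; exists None; rewrite ?lE ?inE.
    left; apply/subsetP=> -[[i j]|]; rewrite ?inE // => /(subsetP (proper_sub H)).
    by rewrite inE.
  - left; apply/subsetP=> -[[[i|] j]|] xt; rewrite ?inE //.
      have : Some (@Tagged _ i (fun i => 'I_(d i).+1) j) \in setl (g @^-1: t) by rewrite lE.
      by move=> /(subsetP H); rewrite inE.
    by rewrite (negbTE (tN j)) in xt.
  - right; apply/existsP; exists (Some i); have [/subsetP H1 [x xi xt]] := properP H.
    apply/properP; split.
      apply/subsetP=> -[[[i'|] j]|] yt; rewrite ?inE //=.
        have : Some (@Tagged _ i' (fun i => 'I_(d i).+1) j) \in setl (g @^-1: t) by rewrite lE.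
        by move=> /H1; rewrite inE /= => /eqP ->.
      by rewrite (negbTE (tN j)) in yt.
    exists (g (inl x)); last by rewrite -lE.
    by case: x xi {xt} => [[i' j]|]; rewrite !inE //= => /eqP ->.
have [j0 j0t] : exists j, Some (@Tagged _ None (fun o => 'I_(d' o).+1) j) \in t.
  by have /set0Pn[j] := r0; rewrite rE => jt; exists j.
apply/orP/andP => [[/subsetP/(_ _ j0t)|/existsP[i H]]|[H1 H2]]; first by rewrite inE.
  have [/subsetP H1 [x xi xt]] := properP H.
  have iN : i = None by have := H1 _ j0t; rewrite inE => /eqP.
  subst i; split.
    apply/subsetP=> -[y|]; rewrite lE ?inE //= => /H1.
    by rewrite inE.
  case: x xi xt => [[[i'|] j]|]; rewrite !inE //=.
    move=> _ xt; apply/orP; left; apply: contraNneq xt => H3.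
    by have := rE j; rewrite H3 inE /= => <-.
  move=> _ xt; apply/orP; right; apply/eqP/setP=> -[y|]; rewrite lE inE /=.
    by apply/negP=> /H1; rewrite inE.
  exact: negbTE.
right; apply/existsP; exists None; apply/properP; split.
  apply/subsetP=> -[[[i|] j]|] xt; rewrite ?inE //=.
  have : Some (@Tagged _ i (fun i => 'I_(d i).+1) j) \in setl (g @^-1: t) by rewrite lE.
  by move=> /(subsetP H1); rewrite inE.
case/orP: H2 => [H2|/eqP H2]; last first.
  by exists None; rewrite ?inE //; have := lE None; rewrite H2 inE /= => <-.
have [j jt] : exists j, j \notin setr (g @^-1: t).
  case: (pickP (fun j => j \notin setr (g @^-1: t))) => [j jt|H3]; first by exists j.
  by case/eqP: H2; apply/setP=> j; rewrite [RHS]inE; have /negbFE := H3 j.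
by exists (g (inr j)); rewrite ?inE // -rE.
Qed.

(** * Attaching a cell along a collapsible subcomplex *)

(* The vertex type consists of [V], of a copy of [V] and of a tip [inr None]. *)
Section AttachCell.
Variable V : finType.
Implicit Types (t : {set V + option V}) (a b s tau S Q : {set V}) (c : bool)
  (B : {set V} -> bool -> bool) (D : {set V} -> {set V} -> bool -> bool).

Definition old_part t : {set V} := inl @^-1: t.
Definition new_part t : {set V} := (fun x => inr (Some x)) @^-1: t.
Definition has_tip t : bool := inr None \in t.

Lemma old_partS t t' : t \subset t' -> old_part t \subset old_part t'.
Proof. exact: preimsetS. Qed.

Lemma new_partS t t' : t \subset t' -> new_part t \subset new_part t'.
Proof. exact: preimsetS. Qed.

Lemma has_tipS t t' : t \subset t' -> has_tip t -> has_tip t'.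
Proof. by move=> tt'; exact: (subsetP tt'). Qed.

(** [B] governs the simplices without vertices of the copy and [D] all others. The separation is
    needed because [K] enters through [B] only, whereas [D] describes simplices over a single
    simplex [tau]. *)
Definition split_complex (B : {set V} -> bool -> bool)
    (D : {set V} -> {set V} -> bool -> bool) : {set {set V + option V}} :=
  [set t | if new_part t == set0 then B (old_part t) (has_tip t) else D (old_part t) (new_part t) (has_tip t)].

Lemma eq_split_complex B B' D D' : B =2 B' ->
  (forall a b c, b != set0 -> D a b c = D' a b c) -> split_complex B D = split_complex B' D'.
Proof.
move=> eB eD; apply/setP=> t; rewrite !inE eB.
by case: eqVneq => // b0; exact: eD.
Qed.

Definition hereditary B D := [/\
  forall a a' c c', a' \subset a -> (c' -> c) -> B a c -> B a' c',
  forall a a' b b' c c', a' \subset a -> b' \subset b -> (c' -> c) ->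
    b' != set0 -> D a b c -> D a' b' c' &
  forall a b c, b != set0 -> D a b c -> B a c].

Lemma complex_split_complex B D : hereditary B D -> complex (split_complex B D).
Proof.
move=> [mB mD DB] s t ts; rewrite !inE.
have [old_ts new_ts] := (old_partS ts, new_partS ts); have tip_ts := has_tipS ts.
have [s0|s0] := eqVneq (new_part s) set0.
  by rewrite s0 subset0 in new_ts; rewrite new_ts; exact: mB.
have [t0 h|t0] := eqVneq (new_part t) set0; last exact: mD.
by apply: mB (DB _ _ _ s0 h).
Qed.

(** The toggle condition read on the three parts of a simplex. The functions [f] add the apex and
    the functions [g] delete it; in each use only one of the three pairs differs from the
    identity. *)
Definition toggles B D B' D' (fa : {set V} -> {set V}) (ga : {set V} -> {set V})
    (fb gb : {set V} -> {set V}) (fc gc : bool -> bool) :=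
  forall a b c, (if b == set0 then B' a c else D' a b c) ->
    ~~ (if b == set0 then B a c else D a b c) ->
    (if fb b == set0 then B' (fa a) (fc c) else D' (fa a) (fb b) (fc c)) /\
    ~~ (if gb b == set0 then B (ga a) (gc c) else D (ga a) (gb b) (gc c)).

Lemma toggle_split_complex u fa ga fb gb fc gc B D B' D' :
  (forall t, [/\ old_part (u |: t) = fa (old_part t), new_part (u |: t) = fb (new_part t)
     & has_tip (u |: t) = fc (has_tip t)]) ->
  (forall t, [/\ old_part (t :\ u) = ga (old_part t), new_part (t :\ u) = gb (new_part t)
     & has_tip (t :\ u) = gc (has_tip t)]) ->
  hereditary B D -> hereditary B' D' -> (forall a c, B a c -> B' a c) ->
  (forall a b c, b != set0 -> D a b c -> D' a b c) ->
  toggles B D B' D' fa ga fb gb fc gc -> texp (split_complex B D) (split_complex B' D').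
Proof.
move=> uf ug mBD mBD' BB' DD' h; apply: (@texp_toggle _ u); split.
- exact: complex_split_complex.
- exact: complex_split_complex.
- apply/subsetP=> t; rewrite !inE; case: eqVneq => [_|]; first exact: BB'.
  exact: DD'.
by move=> t; rewrite !inE; have [-> -> ->] := uf t; have [-> -> ->] := ug t; exact: h.
Qed.

Lemma texp_old v B D B' D' :
  hereditary B D -> hereditary B' D' -> (forall a c, B a c -> B' a c) ->
  (forall a b c, b != set0 -> D a b c -> D' a b c) ->
  toggles B D B' D' (setU [set v]) (fun a => a :\ v) id id id id ->
  texp (split_complex B D) (split_complex B' D').
Proof.
by apply: (@toggle_split_complex (inl v)) => t; split; rewrite ?/has_tip ?inE //; apply/setP=> x;
  rewrite !inE.
Qed.

Lemma texp_new v B D B' D' :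
  hereditary B D -> hereditary B' D' -> (forall a c, B a c -> B' a c) ->
  (forall a b c, b != set0 -> D a b c -> D' a b c) ->
  toggles B D B' D' id id (setU [set v]) (fun b => b :\ v) id id ->
  texp (split_complex B D) (split_complex B' D').
Proof.
by apply: (@toggle_split_complex (inr (Some v))) => t; split; rewrite ?/has_tip ?inE //; apply/setP=> x;
  rewrite !inE.
Qed.

Lemma texp_tip B D B' D' :
  hereditary B D -> hereditary B' D' -> (forall a c, B a c -> B' a c) ->
  (forall a b c, b != set0 -> D a b c -> D' a b c) ->
  toggles B D B' D' id id id id (fun _ => true) (fun _ => false) ->
  texp (split_complex B D) (split_complex B' D').
Proof.
by apply: (@toggle_split_complex (inr None)) => t; split; rewrite ?/has_tip ?inE //; apply/setP=> x;
  rewrite !inE.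
Qed.

(** Every toggle in the construction of [E] is repeated on the simplices that contain the tip, while
    those without the tip stay fixed. *)
Lemma texp_cone (E K : {set {set V}}) (D : {set V} -> {set V} -> bool) :
  texp set0 E -> E \subset K ->
  hereditary (fun a c => ~~ c && (a \in K)) (fun a b c => ~~ c && D a b) ->
  texp (split_complex (fun a c => ~~ c && (a \in K)) (fun a b c => ~~ c && D a b))
       (split_complex (fun a c => a \in if c then E else K) (fun a b c => ~~ c && D a b)).
Proof.
move=> tE EK mF.
pose F A := split_complex (fun a c => a \in if c then A else K) (fun a b c => ~~ c && D a b).
have cE A : complex A -> A \subset K ->
    hereditary (fun a c => a \in if c then A else K) (fun a b c => ~~ c && D a b).
  move=> cA AK; have [mB mD DB] := mF; split=> //.
    move=> a a' [] [] a'a h; first exact: cA.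
    - by move=> /(subsetP AK) aK; have /= := mB a a' false false a'a id aK.
    - by have := h isT.
    by move=> /= aK; have := mB a a' false false a'a id aK.
  by move=> a b [] // b0; exact: (DB a b false).
suff H : E \subset K -> texp (F set0) (F E).
  have -> : split_complex (fun a c => ~~ c && (a \in K)) (fun a b c => ~~ c && D a b) = F set0.
    by apply: eq_split_complex => // a []; rewrite //= inE.
  exact: H.
elim: tE => [_|A A' u tA IH toggles] A'K.
  by apply/texp_refl/complex_split_complex/cE; [exact: complex0|exact: sub0set].
have [cA cA' AA' tg] := toggles; have AK := subset_trans AA' A'K.
apply: texp_trans (IH AK) _; apply: (@texp_old u); try exact: cE.
- by move=> a [] //; exact: (subsetP AA').
- by [].
move=> a b c; case: (b == set0); last by case: c => //= ->.
by case: c => // [/tg|->//]; exact.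
Qed.

Lemma texp_cone_simple_equiv (E K : {set {set V}}) (D : {set V} -> {set V} -> bool) q :
  texp set0 E -> E \subset K -> [set q] \in K ->
  hereditary (fun a c => ~~ c && (a \in K)) (fun a b c => ~~ c && D a b) ->
  simple_equiv (split_complex (fun a c => a \in if c then E else K) (fun a b c => ~~ c && D a b)) (inl q)
      (split_complex (fun a c => ~~ c && (a \in K)) (fun a b c => ~~ c && D a b)) (inl q).
Proof.
move=> tE EK qK mF; apply: texp_simple_equiv; first exact: texp_cone.
rewrite inE (_ : new_part _ = set0) ?eqxx; last by apply/setP=> x; rewrite !inE.
rewrite (_ : old_part _ = [set q]); last by apply/setP=> x; rewrite !inE.
by rewrite /has_tip qK inE.
Qed.

Section Cell.
Variables (K E : {set {set V}}) (tau : {set V}).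
Hypotheses (cK : complex K) (tau0 : tau != set0) (tauK : tau \notin K).
Hypothesis dE : forall s, s \proper tau -> s \in E.
Hypotheses (tE : texp set0 E) (EK : E \subset K).

Let cE : complex E. Proof. by have [] := texp_complex tE. Qed.
Let inK s : s \in E -> s \in K. Proof. exact: (subsetP EK). Qed.

Let ctK : complex (tau |: K).
Proof.
move=> s t ts /setU1P[sE|sK]; last by rewrite setU1r // (cK ts).
have [->|tau_t] := eqVneq t tau; first exact: setU11.
by rewrite setU1r // inK // dE // properEneq tau_t -sE.
Qed.

Let mB0 K' a a' c c' : complex K' -> E \subset K' -> a' \subset a -> (c' -> c) ->
  a \in (if c then E else K') -> a' \in (if c' then E else K').
Proof.
move=> cK' EK'; case: c c' => -[] a'a h; [exact: cE| |by have := h isT|exact: cK'].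
by move=> aE; apply: (subsetP EK'); apply: cE aE.
Qed.

Let setU1_eq v s : v \in s -> v |: s = s.
Proof. by move=> vs; apply/setUidPr; rewrite sub1set. Qed.

(** The first disjunct describes the simplices that do not project onto [tau], with or without tip.
    Those that do project onto it come without tip, and the bound [S] on their new part lets them be
    added gradually. *)
Let D3 (S : {set V}) a b c := (a :|: b \proper tau) || [&& ~~ c, b \subset S & a :|: b == tau].
Let F3 (S : {set V}) := split_complex (fun a c => a \in if c then E else tau |: K) (D3 S).

Let EtK : E \subset tau |: K. Proof. exact: subset_trans EK (subsetUr _ _). Qed.

Let proper_l a b : b != set0 -> a :|: b \proper tau -> a \in E.
Proof. by move=> _ h; exact: dE (sub_proper_trans (subsetUl _ _) h). Qed.

Let mono3 S : hereditary (fun a c => a \in if c then E else tau |: K) (D3 S).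
Proof.
split=> [a a' c c'|a a' b b' c c' a'a b'b c'c _ /orP[h|/and3P[h1 h2 h3]]|a b c b0].
- exact: mB0.
- by apply/orP; left; apply: sub_proper_trans h; exact: setUSS.
- have ab : a' :|: b' \subset tau by rewrite -(eqP h3); exact: setUSS.
  rewrite /D3 properEneq ab andbT; case: eqP => //= _.
  by rewrite (subset_trans b'b h2) !andbT; apply: contra h1; exact: c'c.
case/orP=> [h|/and3P[h1 h2 h3]].
  by have := proper_l b0 h; case: c => // /(subsetP EtK).
rewrite (negbTE h1); have at_ : a \subset tau by rewrite -(eqP h3); exact: subsetUl.
have [->|an] := eqVneq a tau; first exact: setU11.
by rewrite (subsetP EtK) // dE // properEneq an.
Qed.

Let texp13 : texp (split_complex (fun a c => a \in if c then E else tau |: K)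
                        (fun a b c => ~~ c && false)) (F3 set0).
Proof.
apply: texp_tip => //.
- by split=> [a a' c c'|a a' b b' c c' _ _ _ _|a b c _]; rewrite ?andbF //; exact: mB0.
- by move=> a b c _; rewrite andbF.
move=> a b c; case: eqP => [b0|/eqP b0]; first by move=> ->.
move=> /orP[h _|/and3P[_ h _]]; last by rewrite subset0 (negbTE b0) in h.
by rewrite /D3 h.
Qed.

(** When [v] joins [S], the simplices added have [v] in the new part. Their union [a :|: b] is then
    [tau] whether or not the old [v] is in [a], so they pair by the old [v]. *)
Let texp3 S : S \subset tau -> texp (F3 set0) (F3 S).
Proof.
have [n] := ubnP #|S|; elim: n S => // n IHn S leS St.
have [->|[v vS]] := set_0Vmem S; first by apply/texp_refl/complex_split_complex/mono3.
have SvS : S :\ v \subset S by exact: subD1set.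
apply: texp_trans (IHn (S :\ v) _ (subset_trans SvS St)) _.
  by rewrite (cardsD1 v S) vS in leS.
apply: (@texp_old v) => //.
  move=> a b c _ /orP[h|/and3P[h1 h2 h3]]; rewrite /D3 ?h // h1 h3 andbT /=.
  by rewrite (subset_trans h2 SvS) orbT.
have vt : v \in tau by exact: (subsetP St).
move=> a b c; case: eqP => [b0 ->//|_].
rewrite /D3 !negb_or => /orP[->//|/and3P[h1 h2 h3]].
rewrite h1 h3 h2 andbT /= => /andP[_ h4].
have vb : v \in b by apply: contraR h4 => vb; rewrite subsetD1 h2.
have vU : (v |: a) :|: b == tau by rewrite -setUA (eqP h3) setU1_eq.
have vD : (a :\ v) :|: b = tau.
  rewrite -(eqP h3); apply/setP=> x; rewrite !inE.
  by case: (eqVneq x v) => // ->; rewrite vb !orbT.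
by rewrite vU vD properxx eqxx orbT /= andbT.
Qed.

(** The mirror image of [D3]: [S] now bounds the old part, so that shrinking it to the empty set
    clears [tau] away on the old side. *)
Let B6 (S : {set V}) a c := (a \in if c then E else K) || [&& ~~ c, a == tau & a \subset S].
Let D6 (S : {set V}) a b c := (a :|: b \proper tau) || [&& ~~ c, a :|: b == tau & a \subset S].
Let F6 (S : {set V}) := split_complex (B6 S) (D6 S).

Let mono6 S : hereditary (B6 S) (D6 S).
Proof.
split=> [a a' c c' a'a c'c /orP[h|/and3P[h1 h2 h3]]|a a' b b' c c' a'a b'b c'c _|a b c b0].
- by apply/orP; left; apply: mB0 h.
- rewrite /B6; have [a't|a't] := eqVneq a' tau.
    rewrite a't -{2}(eqP h2) h3 /= andbT orbC; apply/orP; left.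
    by apply: contra h1; exact: c'c.
  have : a' \in E by rewrite dE // properEneq a't -(eqP h2).
  by case: c' {c'c} => [->//|/inK ->].
- case/orP=> [h|/and3P[h1 h2 h3]].
    by apply/orP; left; apply: sub_proper_trans h; exact: setUSS.
  have ab : a' :|: b' \subset tau by rewrite -(eqP h2); exact: setUSS.
  rewrite /D6 properEneq ab andbT; case: eqP => //= _.
  by rewrite (subset_trans a'a h3) !andbT; apply: contra h1; exact: c'c.
case/orP=> [h|/and3P[h1 h2 h3]]; rewrite /B6.
  by have := proper_l b0 h; case: c => [->//|/inK ->].
rewrite h1 h3 andbT (negbTE h1).
have at_ : a \subset tau by rewrite -(eqP h2); exact: subsetUl.
have [->|an] := eqVneq a tau; first by rewrite orbT.
by rewrite inK // dE // properEneq an.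
Qed.

Let texp6 S : S \subset tau -> texp (F6 set0) (F6 S).
Proof.
have [n] := ubnP #|S|; elim: n S => // n IHn S leS St.
have [->|[v vS]] := set_0Vmem S; first by apply/texp_refl/complex_split_complex/mono6.
have SvS : S :\ v \subset S by exact: subD1set.
apply: texp_trans (IHn (S :\ v) _ (subset_trans SvS St)) _.
  by rewrite (cardsD1 v S) vS in leS.
have vt : v \in tau by exact: (subsetP St).
apply: (@texp_new v) => //.
- move=> a c /orP[h|/and3P[h1 h2 h3]]; rewrite /B6 ?h // h1 h2 /=.
  by rewrite (subset_trans h3 SvS) orbT.
- move=> a b c _ /orP[h|/and3P[h1 h2 h3]]; rewrite /D6 ?h // h1 h2 /=.
  by rewrite (subset_trans h3 SvS) orbT.
have vb0 b : (v |: b == set0) = false.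
  by apply/eqP=> /setP/(_ v); rewrite !inE eqxx.
move=> a b c; rewrite vb0.
have main : ~~ c -> a :|: b == tau -> a \subset S -> ~~ (a \subset S :\ v) ->
    D6 S a (v |: b) c /\
    ~~ (if b :\ v == set0 then B6 (S :\ v) a c else D6 (S :\ v) a (b :\ v) c).
  move=> h1 h2 h3 h4; have va : v \in a by apply: contraR h4 => va; rewrite subsetD1 h3.
  have vU : a :|: (v |: b) = tau by rewrite setUCA (eqP h2) setU1_eq.
  have vD : a :|: (b :\ v) = tau.
    rewrite -(eqP h2); apply/setP=> x; rewrite !inE.
    by case: (eqVneq x v) => // ->; rewrite va.
  split; first by rewrite /D6 vU eqxx h1 h3 orbT.
  (* If deleting the new [v] empties the new part, what remains is the old simplex [tau] itself; it
     is absent from the smaller complex because [tau] is not in [K]. *)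
  case: eqP vD => [->|_]; rewrite ?setU0 => vD; last first.
    by rewrite /D6 vD properxx eqxx h1 (negbTE h4).
  by rewrite /B6 (negbTE h1) (negbTE h4) !andbF vD (negbTE tauK).
case: eqP => [b0|_].
  rewrite {1 2}/B6 !negb_or => /orP[->//|/and3P[h1 h2 h3]] /andP[_].
  by rewrite h1 h2 /=; apply: main; rewrite // b0 setU0.
rewrite {1 2}/D6 !negb_or => /orP[->//|/and3P[h1 h2 h3]] /andP[_].
by rewrite h1 h2 /=; apply: main.
Qed.

Let F36 : F3 tau = F6 tau.
Proof.
apply: eq_split_complex => [a c|a b c _].
  rewrite /B6; case: c => /=; first by rewrite orbF.
  by rewrite in_setU1 orbC; case: eqP => //= ->; rewrite subxx.
rewrite /D3 /D6; case: c => //=; congr (_ || _).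
apply/andP/andP => -[h1 h2]; split=> //; rewrite -?(eqP h1) -?(eqP h2);
  by [exact: subsetUl|exact: subsetUr].
Qed.

(** With nonempty [b] these are the simplices of the boundary of the simplex on the tip and the copy
    of [tau], which meets the rest of [F4] in the tip only. *)
Let D4 a b c := (a == set0) && ((b \proper tau) || ~~ c && (b == tau)).
Let B4 a c := a \in if c then E else K.
Let F4 := split_complex B4 D4.

Let E0 : set0 \in E. Proof. by apply: dE; rewrite proper0. Qed.

Let mono4 : hereditary B4 D4.
Proof.
split=> [a a' c c'|a a' b b' c c' a'a b'b c'c _ /andP[/eqP a0 h]|a b c b0 /andP[/eqP-> _]].
- exact: mB0.
- rewrite a0 subset0 in a'a; rewrite /D4 a'a /=.
  case/orP: h => [h|/andP[h1 /eqP h2]]; first by rewrite (sub_proper_trans b'b h).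
  rewrite properEneq -{2 3}h2 b'b andbT h2; case: eqP => //= _; rewrite andbT.
  by apply: contra h1.
by rewrite /B4; case: c => //; exact: inK.
Qed.

Let texp46 : texp F4 (F6 set0).
Proof.
apply: texp_tip => //.
- by move=> a c; rewrite /B4 /B6 => ->.
- move=> a b c _ /andP[/eqP-> h]; rewrite /D6 !set0U subxx andbT; exact: h.
move=> a b c; case: eqP => [b0|/eqP b0].
  rewrite /B6 /B4 => /orP[->//|/and3P[_ /eqP -> ]].
  by rewrite subset0 (negbTE tau0).
rewrite {1}/D6 subset0 andbA => /orP[h1|/andP[h1 h2]]; last first.
  by rewrite /D4 h2; move: h1; rewrite (eqP h2) set0U => ->; rewrite orbT.
move=> h2; rewrite /D6 h1; split=> //; apply: contra h2 => /andP[/eqP a0 _].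
by move: h1; rewrite /D4 a0 set0U eqxx => ->.
Qed.

(** For [Q] a vertex this is the boundary of the simplex spanned by [Q] and the copy of [tau]. An
    edge [Q] gives the common thickening of the spheres at its two ends. *)
Definition sphere_at (Q : {set V}) a b :=
  (a \subset Q) && (b \proper tau) || (a == set0) && (b == tau).
Definition with_sphere (Q : {set V}) := split_complex (fun a c => ~~ c && (a \in K))
  (fun a b c => ~~ c && sphere_at Q a b).

Lemma sphere_atS Q a a' b b' : a' \subset a -> b' \subset b ->
  sphere_at Q a b -> sphere_at Q a' b'.
Proof.
move=> a'a b'b /orP[/andP[h1 h2]|/andP[/eqP h1 /eqP h2]].
  by rewrite /sphere_at (subset_trans a'a h1) (sub_proper_trans b'b h2).
have /eqP a'0 : a' == set0 by rewrite -subset0 -h1.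
rewrite /sphere_at a'0 sub0set eqxx properEneq -{2}h2 b'b.
by case: (b' == tau).
Qed.

Lemma hereditary_sphere Q : Q \in K -> hereditary (fun a c => ~~ c && (a \in K))
  (fun a b c => ~~ c && sphere_at Q a b).
Proof.
move=> QK; split=> [a a' [] [] // a'a|a a' b b' [] [] // a'a b'b|a b [] //= b0].
- by move=> h; have := h isT.
- by move=> _; exact: cK.
- by move=> h; have := h isT.
- by move=> _ _; exact: sphere_atS.
case/orP=> /andP[h _]; first exact: cK h QK.
by rewrite (eqP h); apply: cK QK; exact: sub0set.
Qed.

(** The thickening over the edge collapses onto the sphere at either end: the simplices that contain
    the other end pair by the chosen one. *)
Lemma slide_sphere p q r : [set p] \in K -> [set q; r] \in K ->
  simple_equiv (with_sphere [set q]) (inl p) (with_sphere [set r]) (inl p).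
Proof.
have half q' r' : [set p] \in K -> [set q'; r'] \in K ->
    simple_equiv (with_sphere [set q'; r']) (inl p) (with_sphere [set q']) (inl p).
  move=> pK qrK; apply: texp_simple_equiv; last first.
    rewrite inE (_ : new_part _ = set0) ?eqxx; last by apply/setP=> x; rewrite !inE.
    rewrite (_ : old_part _ = [set p]); last by apply/setP=> x; rewrite !inE.
    by rewrite /has_tip pK inE.
  have q'K : [set q'] \in K by apply: cK qrK; rewrite sub1set !inE eqxx.
  apply: (@texp_old q') => //; try exact: hereditary_sphere.
    move=> a b [] //= _ /orP[/andP[h1 h2]|h]; rewrite /sphere_at ?h ?orbT //.
    by rewrite h2 (subset_trans h1) // sub1set !inE eqxx.
  move=> a b [] //=; case: eqP => // _; first by move=> ->.
  rewrite /sphere_at !negb_or => /orP[/andP[h1 h2]|->//]; last by rewrite andbF.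
  rewrite h2 subUset h1 sub1set !inE eqxx /= andbT => /andP[h3 h4]; split=> //.
  have bt : b == tau = false by apply/negP=> /eqP bt; rewrite bt properxx in h2.
  rewrite bt andbF !andbT; apply: contra h3 => /subsetP h3; apply/subsetP=> x xa.
  have [->|xq] := eqVneq x q'; first by rewrite inE.
  by apply: h3; rewrite !inE xq.
move=> pK qrK; apply: simple_equiv_trans (half r q pK _); last by rewrite setUC.
by rewrite setUC; apply: simple_equiv_sym; apply: half.
Qed.

Let D7 u a b c := (a \subset [set u]) && (b \proper tau) || [&& ~~ c, a == set0 & b == tau].

Let mono7 u : [set u] \in E -> hereditary B4 (D7 u).
Proof.
move=> uE; split=> [a a' c c'|a a' b b' c c' a'a b'b c'c _|a b c b0].
- exact: mB0.
- case/orP=> [h|/and3P[h1 h2 h3]].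
    move: h => /andP[h1 h2].
    by rewrite /D7 (subset_trans a'a h1) (sub_proper_trans b'b h2).
  have : sphere_at [set u] a' b' by apply: sphere_atS a'a b'b _; rewrite /sphere_at h2 h3 orbT.
  rewrite /D7 /sphere_at => /orP[->//|->]; rewrite andbT orbC; apply/orP; left.
  by apply: contra h1; exact: c'c.
case/orP=> [/andP[h _]|/and3P[_ /eqP -> _]]; rewrite /B4.
  by have := cE h uE; case: c => //; exact: inK.
by case: c => //; exact: inK.
Qed.

(** With [texp87], this moves the sphere from the tip to [u] along the edge between them, which
    belongs to the cone over [E]: the thickened sphere collapses to both. *)
Let texp47 u : [set u] \in E -> texp F4 (split_complex B4 (D7 u)).
Proof.
move=> uE; apply: texp_tip => //; first exact: mono7.
  move=> a b c _ /andP[/eqP -> /orP[h|/andP[h1 h2]]]; rewrite /D7 ?sub0set ?h //.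
  by rewrite h1 h2 eqxx orbT.
move=> a b c; case: eqP => [b0 ->//|_].
rewrite {1}/D7 => /orP[/andP[h1 h2]|/and3P[h1 h2 h3]]; last by rewrite /D4 h1 h2 h3 orbT.
rewrite {1}/D4 h2 /= andbT => a0; rewrite /D7 /D4 h1 h2 (negbTE a0); split=> //.
Qed.

Let texp87 u : [set u] \in E ->
  texp (split_complex B4 (fun a b c => ~~ c && sphere_at [set u] a b)) (split_complex B4 (D7 u)).
Proof.
move=> uE; apply: (@texp_old u) => //; last 1 first.
- move=> a b c; case: eqP => [b0 ->//|_].
  rewrite {1}/D7 => /orP[/andP[h1 h2]|/and3P[h1 h2 h3]]; last first.
    by rewrite h1 /sphere_at h2 h3 orbT.
  rewrite /sphere_at h1 h2 /= andbT negbK => ->; split=> //.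
  by rewrite /D7 h2 subUset h1 sub1set inE eqxx.
- have [_ mD DB] := hereditary_sphere (inK uE); split=> //.
  + by move=> a a' c c'; exact: mB0.
  move=> a b c b0 h; have := DB a b c b0 h; rewrite /B4.
  by case: c {h}.
- exact: mono7.
by move=> a b [] //= b0 /orP[h|h]; rewrite /D7 h ?orbT.
Qed.

(* Let [z] be the tip and [tau'] the copy of [tau]. Adding first [z * E], then the
   joins with [z] of the simplices of [tau :|: tau'] that do not project onto [tau],
   and finally the simplex [tau :|: tau'] expands [tau |: K]. The result collapses,
   from the side of [tau], to [K] with [z * E] and with the boundary of [z |: tau']
   attached at [z]. This sphere slides to [u], and [z * E] collapses. *)
Lemma attach_cell_sphere p u : [set p] \in K -> [set u] \in E ->
  simple_equiv (tau |: K) p (with_sphere [set u]) (inl p).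
Proof.
move=> pK uE.
have inl_inj : injective (@inl V (option V)) by move=> ? ? [].
have pin X D : hereditary (fun a c => a \in if c then E else X) D -> [set p] \in X ->
    [set inl p] \in split_complex (fun a c => a \in if c then E else X) D.
  move=> _ pX; rewrite inE (_ : new_part _ = set0) ?eqxx; last by apply/setP=> x; rewrite !inE.
  rewrite (_ : old_part _ = [set p]); last by apply/setP=> x; rewrite !inE.
  by rewrite /has_tip inE.
have ptK : [set p] \in tau |: K by rewrite inE pK orbT.
apply: simple_equiv_trans (simple_equiv_rename _ _ inl_inj) _.
have -> : [set inl @: s | s : {set V} in tau |: K] =
    split_complex (fun a c => ~~ c && (a \in tau |: K)) (fun a b c => ~~ c && false).
  apply/setP=> t; rewrite mem_imset_complex // [RHS]inE.
  have -> : (t \subset inl @: setT) = (new_part t == set0) && ~~ has_tip t.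
    apply/subsetP/andP => [h|[/eqP b0 zt] [x|[x|]] xt].
    - split; first by apply/eqP/setP=> x; rewrite !inE; apply/negP=> /h/imsetP[].
      by apply/negP=> /h/imsetP[].
    - exact: imset_f.
    - by have := in_set0 x; rewrite -b0 inE xt.
    by rewrite /has_tip xt in zt.
  by case: eqP; rewrite ?andbF.
apply: simple_equiv_trans (simple_equiv_sym (texp_cone_simple_equiv tE EtK ptK _)) _.
  split=> [a a' [] [] // a'a|a a' b b' c c' _ _ _ _|a b c _]; rewrite ?andbF //=.
    by move=> h; have := h isT.
  by move=> _; exact: ctK.
apply: simple_equiv_trans (simple_equiv_sym (texp_simple_equiv texp13 _)) _.
  apply: pin => //.
  by split=> [a a' c c'|a a' b b' c c' _ _ _ _|a b c _]; rewrite ?andbF //; exact: mB0.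
apply: simple_equiv_trans (simple_equiv_sym (texp_simple_equiv (texp3 (subxx _)) _)) _.
  exact: pin.
have p4 : [set inl p] \in F4 by exact: (pin K).
rewrite F36; apply: simple_equiv_trans (texp_simple_equiv (texp6 (subxx _)) _) _.
  exact: (subsetP (texp_sub texp46)).
apply: simple_equiv_trans (texp_simple_equiv texp46 p4) _.
apply: simple_equiv_trans (simple_equiv_sym (texp_simple_equiv (texp47 uE) p4)) _.
have [_ mD DB] := hereditary_sphere (inK uE).
apply: simple_equiv_trans (texp_simple_equiv (texp87 uE) _) _.
  apply: pin => //; split=> //; first by move=> a a' c c'; exact: mB0.
  by move=> a b c b0 h; have := DB a b c b0 h; case: c {h}.
exact: (texp_cone_simple_equiv tE EK pK (hereditary_sphere (inK uE))).
Qed.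

Lemma slide_sphere_path p u v : [set p] \in K ->
  connect (fun x y => [set x; y] \in K) u v ->
  simple_equiv (with_sphere [set u]) (inl p) (with_sphere [set v]) (inl p).
Proof.
move=> pK /connectP[w]; elim: w u => [u _ -> |x w IHw u /= /andP[ux h] vE].
  exact: simple_equiv_refl.
exact: simple_equiv_trans (slide_sphere pK ux) (IHw _ h vE).
Qed.

(** As [tau] is nonempty, its vertices can be numbered by ['I_#|tau|.-1.+1]; the dimension of the
    new sphere is that of [tau]. *)
Lemma add_sphere_with_sphere p : [set p] \in K ->
  simple_equiv (add_sphere 'I_#|tau|.-1.+1 K p) (inl p) (with_sphere [set p]) (inl p).
Proof.
move=> pK.
have n_tau : #|tau|.-1.+1 = #|tau| by rewrite prednK // card_gt0.
pose g (x : V + 'I_#|tau|.-1.+1) : V + option V :=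
  match x with inl v => inl v | inr j => inr (Some (enum_val (cast_ord n_tau j))) end.
have g_inj : injective g.
  by move=> [x|x] [y|y] //= [] => [->//|/enum_val_inj/cast_ord_inj ->].
suff -> : with_sphere [set p] = [set g @: s | s : {set _} in add_sphere 'I_#|tau|.-1.+1 K p].
  exact: simple_equiv_rename.
apply/setP=> t; rewrite mem_imset_complex // [in LHS]inE [in RHS]inE.
have lE : setl (g @^-1: t) = old_part t by apply/setP=> x; rewrite !inE.
have rE j : (j \in setr (g @^-1: t)) = (enum_val (cast_ord n_tau j) \in new_part t) by rewrite !inE.
have gs : (t \subset g @: setT) = ~~ has_tip t && (new_part t \subset tau).
  apply/subsetP/andP => [h|[zt /subsetP bt] [x|[x|]] xt].
  - split; first by apply/negP=> /h/imsetP[[]].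
    by apply/subsetP=> x; rewrite inE => /h/imsetP[[//|j] _ [->]]; exact: enum_valP.
  - by apply/imsetP; exists (inl x).
  - have x_tau : x \in tau by apply: bt; rewrite inE.
    apply/imsetP; exists (inr (cast_ord (esym n_tau) (enum_rank_in x_tau x))) => //=.
    by rewrite cast_ordKV enum_rankK_in.
  by rewrite /has_tip xt in zt.
have surj x : x \in tau -> exists j, x = enum_val (cast_ord n_tau j).
  move=> x_tau; exists (cast_ord (esym n_tau) (enum_rank_in x_tau x)).
  by rewrite cast_ordKV enum_rankK_in.
rewrite gs lE; case: (has_tip t) => /=; first by rewrite if_same.
have [bt|bt] := boolP (new_part t \subset tau); last first.
  case: eqP bt => [->|_ bt]; first by rewrite sub0set.
  apply/negbTE; apply: contra bt => /orP[/andP[_ /proper_sub]//|/andP[_ /eqP ->]//].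
have -> : (setr (g @^-1: t) == set0) = (new_part t == set0).
  apply/eqP/eqP => h; last by apply/setP=> j; rewrite rE h !inE.
  apply/setP=> x; rewrite [RHS]inE; apply/negP=> xb.
  have [j xE] := surj x (subsetP bt _ xb).
  by have := rE j; rewrite h inE -xE xb.
have -> : (setr (g @^-1: t) == setT) = (new_part t == tau).
  apply/eqP/eqP => h; last by apply/setP=> j; rewrite rE h !inE enum_valP.
  apply/eqP; rewrite eqEsubset bt; apply/subsetP=> x /surj[j ->].
  by rewrite -rE h inE.
case: ifP => // _; rewrite /sphere_at /= properEneq bt andbT.
have [a0|a0] := eqVneq (old_part t) set0; first by rewrite a0 sub0set /= orbT orNb.
by rewrite /= !orbF.
Qed.

(** The new sphere arises at a vertex [u] of the collapsible complex and slides along edges of [K]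
    to the base point, where it becomes another lobe. *)
Lemma wedgelike_attach p u : [set p] \in K -> [set u] \in E ->
  connect (fun x y => [set x; y] \in K) u p ->
  wedgelike K p -> wedgelike (tau |: K) p.
Proof.
move=> pK uE up Kp.
apply: wedgelike_simple_equiv (wedgelike_add_sphere #|tau|.-1 Kp).
apply: simple_equiv_trans (add_sphere_with_sphere pK) _.
apply: simple_equiv_trans (simple_equiv_sym (slide_sphere_path pK up)) _.
exact/simple_equiv_sym/attach_cell_sphere.
Qed.

End Cell.
End AttachCell.

(** * Attaching joins *)

Section AttachJoin.
Variable V : finType.
Implicit Types (K L E M Cur T : {set {set V}}) (S alpha tau c e m r t : {set V}) (p q u : V).

Definition edge_connect K := connect (fun x y => [set x; y] \in K).

Lemma edge_connectS K K' x y : K \subset K' -> edge_connect K x y -> edge_connect K' x y.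
Proof.
move=> KK'; apply: (connect_sub _) => {}x {}y xy; apply: connect1.
exact: (subsetP KK').
Qed.

(* [E * L] is where the boundary of [alpha * L] gets contracted. *)
Definition attachable S L := forall Cur alpha E p u,
  complex Cur -> [set p] \in Cur -> alpha != set0 -> [disjoint alpha & S] ->
  (forall e, e \in E -> [disjoint e & S]) ->
  (forall c, c \proper alpha -> c \in E) -> texp set0 E ->
  (forall e r, e \in E -> r \in L -> e :|: r \in Cur) -> alpha \notin Cur ->
  [set u] \in E -> edge_connect Cur u p -> wedgelike Cur p ->
  wedgelike (Cur :|: [set alpha :|: r | r : {set V} in L]) p.

(** The start of the induction: [alpha] alone is attached, a single cell whose boundary lies in
    [E]. *)
Lemma attachable0 S : attachable S [set set0].
Proof.
move=> Cur alpha E p u cCur pCur al0 _ _ dal tE ECur alCur uE up wCur.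
rewrite imset_set1 setU0 setUC; apply: (@wedgelike_attach _ _ E _ _ _ _ _ _ _ _ u) => //.
by apply/subsetP=> e eE; rewrite -(setU0 e) ECur // inE.
Qed.

Section Step.
Variables (alpha tau : {set V}) (E : {set {set V}}) (q : V).
Hypotheses (dal : forall c, c \proper alpha -> c \in E) (tE : texp set0 E).
Hypotheses (tau0 : tau != set0) (q_tau : q \notin tau).
Hypothesis tau_al : [disjoint tau & alpha].
Hypothesis tau_E : forall e, e \in E -> [disjoint tau & e].

Let cE : complex E. Proof. by have [] := texp_complex tE. Qed.

(** This is the join of [q] with the boundary of [tau], which makes [A] a cone with tip [q]. *)
Let C := [set c : {set V} | c :\ q \proper tau].
Let A := [set e :|: c | e : {set V} in alpha |: E, c : {set V} in C].
(* A collapsible complex containing the boundary of [alpha :|: tau]. *)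
Definition step_complex := A :|: [set tau :|: e | e : {set V} in E].

Let cC : complex C.
Proof. by move=> s t ts; rewrite !inE; apply: sub_proper_trans; exact: setSD. Qed.

Let calE : complex (alpha |: E).
Proof.
move=> s t ts; rewrite !inE => /orP[/eqP sal|sE]; last by rewrite (cE ts sE) orbT.
by have [//|tal] := eqVneq t alpha; rewrite dal // properEneq tal -sal.
Qed.

Let cA : complex A.
Proof.
move=> s t ts /imset2P[e c eE cC' sE]; apply/imset2P.
exists (t :&: e) (t :&: c); first by apply: calE eE; exact: subsetIr.
  by apply: cC cC'; exact: subsetIr.
by rewrite -setIUr -sE; apply/esym/setIidPl.
Qed.

(** The cone [A] takes one toggle. Then [tau * E] is attached along the join of [E] with the
    boundary of [tau], which lies in [A]; this is an expansion because [E] is collapsible. *)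
Lemma texp_step_complex : texp set0 step_complex.
Proof.
apply: (texp_trans (B := A)).
  apply: (@texp_toggle _ q); split=> //; first exact: complex0.
    exact: sub0set.
  move=> t /imset2P[e c eE cC' tE'] _; rewrite inE; split=> //.
  apply/imset2P; exists e (q |: c) => //; last by rewrite tE' setUCA.
  move: cC'; rewrite !inE; apply: sub_proper_trans.
  by apply/subsetP=> x; rewrite !inE; case: eqP.
apply: texp_join => // [c e ct eE|e eE].
  apply/imset2P; exists e c; rewrite 1?setUC ?inE ?eE ?orbT //.
  by apply: sub_proper_trans ct; exact: subD1set.
split; first exact: tau_E.
apply/negP=> /imset2P[e' c e'E]; rewrite inE => /properP[_ [x xt xc]].
move=> /setP/(_ x); rewrite !inE xt /= => /esym/orP[xe'|xc'].
  have : [disjoint tau & e'] by move: e'E; rewrite !inE => /orP[/eqP->//|/tau_E].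
  by move=> /disjointFr/(_ xt); rewrite xe'.
by move: xc; rewrite !inE xc' andbT negbK => /eqP xq; move: q_tau; rewrite -xq xt.
Qed.

(** A proper face misses a vertex of [tau], and then lies in [A], or contains [tau] and misses a
    vertex of [alpha], and then lies in [tau * E]. *)
Lemma step_complex_boundary c : c \proper alpha :|: tau -> c \in step_complex.
Proof.
move=> ct; have cE' : c = (c :&: alpha) :|: (c :&: tau).
  by rewrite -setIUr; apply/esym/setIidPl/proper_sub.
have [h|h] := eqVneq (c :&: tau) tau.
  rewrite inE; apply/orP; right; apply/imsetP; exists (c :&: alpha).
    apply: dal; rewrite properEneq subsetIr andbT; apply: contraTneq ct => h'.
    by rewrite cE' h h' properxx.
  by rewrite setUC -[in RHS]h.
rewrite inE; apply/orP; left; apply/imset2P; exists (c :&: alpha) (c :&: tau) => //.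
  have [->|h'] := eqVneq (c :&: alpha) alpha; first by rewrite setU11.
  by rewrite setU1r // dal // properEneq h' subsetIr.
rewrite inE; apply: sub_proper_trans (subD1set _ _) _.
by rewrite properEneq h subsetIr.
Qed.

Lemma step_complex_apex : [set q] \in step_complex.
Proof.
rewrite inE; apply/orP; left; apply/imset2P; exists set0 [set q].
- have [->|al0] := eqVneq alpha set0; first exact: setU11.
  by rewrite setU1r // dal // proper0.
- by rewrite inE setDv proper0.
by rewrite set0U.
Qed.

Lemma step_complex_join L Cur :
  (forall e c r, e \in alpha |: E -> c :\ q \proper tau -> r \in L -> e :|: c :|: r \in Cur) ->
  (forall e r, e \in E -> r \in L -> tau :|: e :|: r \in Cur) ->
  forall e r, e \in step_complex -> r \in L -> e :|: r \in Cur.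
Proof.
move=> ACur tauCur e r; rewrite inE => /orP[/imset2P[e' c e'E cC' ->]|/imsetP[e' e'E ->]] rL.
  by apply: ACur => //; move: cC'; rewrite inE.
exact: tauCur.
Qed.

Lemma complex_attach_step L Cur : complex Cur -> complex L ->
  (forall e c r, e \in alpha |: E -> c :\ q \proper tau -> r \in L -> e :|: c :|: r \in Cur) ->
  (forall e r, e \in E -> r \in L -> tau :|: e :|: r \in Cur) ->
  complex (Cur :|: [set alpha :|: tau :|: r | r : {set V} in L]).
Proof.
move=> cCur cL ACur tauCur; apply: complex_join => // c r /step_complex_boundary.
exact: step_complex_join.
Qed.

(** The passage from [alpha], [E] to [alpha :|: tau], [step_complex], with [q] as the vertex
    connected to the base point. Only [tau] has to be nonempty, which allows an empty [alpha] at the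
    outermost level. *)
Lemma wedgelike_attach_step S L Cur p : attachable S L ->
  complex Cur -> [set p] \in Cur ->
  [disjoint alpha & S] -> (forall e, e \in E -> [disjoint e & S]) ->
  [disjoint tau & S] -> q \notin S ->
  (forall e c r, e \in alpha |: E -> c :\ q \proper tau -> r \in L -> e :|: c :|: r \in Cur) ->
  (forall e r, e \in E -> r \in L -> tau :|: e :|: r \in Cur) ->
  alpha :|: tau \notin Cur -> edge_connect Cur q p -> wedgelike Cur p ->
  wedgelike (Cur :|: [set alpha :|: tau :|: r | r : {set V} in L]) p.
Proof.
move=> attL cCur pCur alS ES tauS qS ACur tauCur atCur qp wCur.
apply: (attL Cur (alpha :|: tau) step_complex p q) => //.
- by apply: contraNneq tau0 => h; rewrite -subset0 -h subsetUr.
- rewrite disjoints_subset subUset -!disjoints_subset alS; exact: tauS.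
- move=> e; rewrite inE => /orP[/imset2P[e' c e'E cC' ->]|/imsetP[e' e'E ->]].
    rewrite disjoints_subset subUset -!disjoints_subset; apply/andP; split.
      by move: e'E; rewrite !inE => /orP[/eqP->|/ES].
    rewrite disjoints_subset; apply/subsetP=> x xc; rewrite inE.
    have [->//|xq] := eqVneq x q.
    move: cC'; rewrite inE => /proper_sub/subsetP/(_ x); rewrite !inE xq xc => /(_ isT) xt.
    by rewrite (disjointFr tauS xt).
  rewrite disjoints_subset subUset -!disjoints_subset; apply/andP; split => //.
  exact: ES.
- exact: step_complex_boundary.
- exact: texp_step_complex.
- exact: step_complex_join.
exact: step_complex_apex.
Qed.

End Step.

Section AttachApex.
Variables (M L : {set {set V}}) (SM S : {set V}) (q : V).
Hypotheses (cM : complex M) (qM : [set q] \in M)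
  (M_SM : forall m, m \in M -> m \subset SM)
  (M_apex : forall tau, tau \in M -> q |: tau \notin M ->
    forall c, c \proper tau -> q |: c \in M).
Hypotheses (cL : complex L) (L0 : set0 \in L)
  (L_S : forall r, r \in L -> r \subset S).
Hypotheses (SM_S : [disjoint SM & S]) (attL : attachable S L).
Variables (Cur E : {set {set V}}) (alpha : {set V}) (p : V).
Hypotheses (cCur : complex Cur) (pCur : [set p] \in Cur).
Hypotheses (dal : forall c, c \proper alpha -> c \in E) (tE : texp set0 E).
Hypotheses (al_SM : [disjoint alpha & SM]) (al_S : [disjoint alpha & S])
  (E_SM : forall e, e \in E -> [disjoint e & SM])
  (E_S : forall e, e \in E -> [disjoint e & S]).
Hypotheses (EML : forall e m r, e \in E -> m \in M -> r \in L -> e :|: m :|: r \in Cur)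
  (alqL : forall r, r \in L -> alpha :|: [set q] :|: r \in Cur)
  (alM : forall m, m \in M -> ~~ (m \subset [set q]) -> alpha :|: m \notin Cur).

Let qSM : q \in SM. Proof. by have := M_SM qM; rewrite sub1set. Qed.

Let qU1 m : q |: (m :\ q) = q |: m.
Proof. by apply/setP=> x; rewrite !inE; case: eqP. Qed.

(** The star of [q] in [M]; its simplices are the ones that can be added by expansions. *)
Let C := [set m in M | q |: m \in M].
Let J T := [set alpha :|: m :|: r | m : {set V} in T, r : {set V} in L].

Let restrM m r : m \in M -> r \in L -> (alpha :|: m :|: r) :&: SM = m.
Proof.
move=> mM rL; apply/setP=> x; rewrite !inE.
have [xm|xm] := boolP (x \in m); first by rewrite (subsetP (M_SM mM)) ?orbT.
have [xSM|] := boolP (x \in SM); rewrite ?andbF // orbF andbT.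
rewrite (disjointFl al_SM xSM) /=; apply/negP=> /(subsetP (L_S rL)).
by rewrite (disjointFr SM_S xSM).
Qed.

Let cJ T : T \subset M ->
  (forall t c, t \in T -> c \proper t -> c \in T \/ c \in C) ->
  complex (Cur :|: J C :|: J T).
Proof.
move=> TM dT s t ts; rewrite -setUA !in_setU => /orP[sCur|].
  by rewrite (cCur ts sCur).
suff h m r : m \in M -> r \in L -> (m \in T) || (m \in C) -> s = alpha :|: m :|: r ->
    [|| t \in Cur, t \in J C | t \in J T].
  move=> /orP[]/imset2P[m r mT rL sE]; apply: h sE => //.
  - by move: mT; rewrite inE => /andP[].
  - by rewrite mT orbT.
  - exact: (subsetP TM).
  by rewrite mT.
move=> mM rL mTC sE.
have tE' : t = (t :&: alpha) :|: (t :&: m) :|: (t :&: r).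
  by rewrite -!setIUr -sE; apply/esym/setIidPl.
have mM' : t :&: m \in M by apply: cM mM; exact: subsetIr.
have rL' : t :&: r \in L by apply: cL rL; exact: subsetIr.
have [h|h] := eqVneq (t :&: alpha) alpha; last first.
  rewrite {1}tE' EML //; apply: dal; rewrite properEneq h; exact: subsetIr.
have [mC|mC] := boolP (t :&: m \in C).
  apply/or3P/Or32/imset2P; exists (t :&: m) (t :&: r) => //.
  by rewrite {1}tE' h.
suff mT : t :&: m \in T.
  apply/or3P/Or33/imset2P; exists (t :&: m) (t :&: r) => //.
  by rewrite {1}tE' h.
have CC m' : m' \in C -> m' :&: t \in C.
  rewrite !inE => /andP[m1 m2]; rewrite (cM (subsetIl m' t) m1) /=.
  by apply: cM m2; apply: setUS; exact: subsetIl.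
case/orP: mTC => [mT|/CC]; last by rewrite setIC (negbTE mC).
have [->//|h'] := eqVneq (t :&: m) m.
have tm : t :&: m \proper m by rewrite properEneq h' subsetIr.
have [//|] := dT _ _ mT tm.
by rewrite (negbTE mC).
Qed.

Let J0 : J set0 = set0.
Proof. by apply/setP=> t; rewrite [RHS]inE; apply/negP=> /imset2P[m r]; rewrite inE. Qed.

(** In the star of [q] adding or deleting [q] is always possible. The exceptional simplices with [m]
    inside [[set q]] are already in [Cur] by [alqL], and by [alM] deleting [q] from any other one
    does not lead back into [Cur]. *)
Let toggleC : texp Cur (Cur :|: J C).
Proof.
apply: (@texp_toggle _ q); split=> //.
- rewrite -(setU0 (Cur :|: J C)) -J0; apply: cJ; first exact: sub0set.
  by move=> t c; rewrite inE.
- exact: subsetUl.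
move=> t; rewrite inE => /orP[->//|/imset2P[m r]]; rewrite inE => /andP[mM qmM] rL tE' tCur.
have mq : ~~ (m \subset [set q]).
  apply: contra tCur => mq; rewrite tE'; apply: cCur (alqL rL).
  by rewrite setSU // setUS.
have mq' : ~~ (m :\ q \subset [set q]).
  by apply: contra mq => h; rewrite -(setUidPr h) [_ :|: _]setUC qU1 subsetUr.
split.
  rewrite inE; apply/orP; right; apply/imset2P; exists (q |: m) r => //.
    by rewrite inE qmM setUA setUid.
  by rewrite tE' -!setUA setUCA.
apply: contra (alM (cM (subD1set m q) mM) mq'); apply: cCur; rewrite tE'.
have q_al : q \notin alpha by rewrite (disjointFl al_SM).
have q_r : q \notin r.
  by apply/negP=> /(subsetP (L_S rL)); rewrite (disjointFr SM_S).
apply/subsetP=> x; rewrite !inE; case: (eqVneq x q) => [->|_] /=.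
  by rewrite (negbTE q_al).
by case: (x \in alpha) => //= ->.
Qed.

Lemma wedgelike_attach_apex : edge_connect Cur q p -> wedgelike Cur p ->
  wedgelike (Cur :|: [set alpha :|: m :|: r | m : {set V} in M, r : {set V} in L]) p.
Proof.
move=> qp wCur.
have w1 : wedgelike (Cur :|: J C) p.
  by apply: wedgelike_simple_equiv wCur; apply/simple_equiv_sym/texp_simple_equiv.
have dT t c : t \in M -> t \notin C -> c \proper t -> q |: c \in M /\ c \in C.
  rewrite !inE => tM; rewrite tM /= => qt ct; have qc := M_apex tM qt ct.
  by rewrite qc andbT; split=> //; apply: cM qc; exact: subsetUr.
(* The proper faces of each [tau] outside the star lie in the star by [M_apex], so these [tau] can
   be attached in any order, and the induction may remove an arbitrary one from [T]. *)
have H T : T \subset M :\: C -> wedgelike (Cur :|: J C :|: J T) p.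
  have [n] := ubnP #|T|; elim: n T => // n IHn T leT TM.
  have [->|[tau tauT]] := set_0Vmem T; first by rewrite J0 setU0.
  have TD : T :\ tau \subset M :\: C by apply: subset_trans TM; exact: subD1set.
  have leD : #|T :\ tau| < n by rewrite (cardsD1 tau T) tauT in leT.
  have := subsetP TM _ tauT; rewrite inE => /andP[tauC tauM].
  have -> : Cur :|: J C :|: J T = Cur :|: J C :|: J (T :\ tau) :|:
      [set alpha :|: tau :|: r | r : {set V} in L].
    rewrite -[RHS]setUA; congr (_ :|: _); apply/setP=> t; rewrite in_setU.
    apply/imset2P/orP => [[m r mT rL ->]|[/imset2P[m r mT rL ->]|/imsetP[r rL ->]]].
    - have [->|mt] := eqVneq m tau; [right; apply/imsetP|left; apply/imset2P].
        by exists r.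
      by exists m r; rewrite // !inE mt.
    - by exists m r => //; move: mT; rewrite inE => /andP[].
    by exists tau r.
  have q_tau : q \notin tau.
    apply: contra tauC => qt; rewrite inE tauM /=.
    by rewrite (setUidPr _) // sub1set.
  have tau0 : tau != set0.
    by apply: contraNneq tauC => ->; rewrite inE setU0 qM (cM _ qM) ?sub0set.
  have CC c : c :\ q \proper tau -> c \in C.
    move=> /(dT _ _ tauM tauC)[+ _]; rewrite qU1 inE => h; rewrite h andbT.
    by apply: cM h; exact: subsetUr.
  have sub0 : Cur \subset Cur :|: J C :|: J (T :\ tau) by rewrite -setUA subsetUl.
  apply: (@wedgelike_attach_step alpha tau E q dal tE tau0 q_tau _ _ S L) => //.
  - by rewrite disjoint_sym; apply: disjointWr al_SM; exact: M_SM.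
  - by move=> e eE; rewrite disjoint_sym; apply: disjointWr (E_SM eE); exact: M_SM.
  - apply: cJ; first by apply: subset_trans TD _; exact: subsetDl.
    move=> t c /(subsetP TD); rewrite inE => /andP[tC tM] ct; right.
    by have [] := dT t c tM tC ct.
  - exact: (subsetP sub0).
  - by apply: disjointWl SM_S; exact: M_SM.
  - by rewrite (disjointFr SM_S).
  - move=> e c r; rewrite in_setU1 => /orP[/eqP ->|eE] cq rL.
      rewrite !in_setU; apply/orP; left; apply/orP; right.
      by apply/imset2P; exists c r => //; exact: CC.
    apply: (subsetP sub0); apply: EML => //.
    by have := CC _ cq; rewrite inE => /andP[].
  - move=> e r eE rL; apply: (subsetP sub0).
    by rewrite [tau :|: e]setUC; exact: EML.
  - rewrite !in_setU !negb_or -andbA; apply/and3P; split.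
    + apply: alM => //; apply: contra q_tau; rewrite subset1 (negbTE tau0) orbF => /eqP ->.
      exact: set11.
    + apply/negP=> /imset2P[m r mC rL]; rewrite -[alpha :|: tau]setU0 => h.
      have := congr1 (fun t => t :&: SM) h.
      have mM : m \in M by move: mC; rewrite inE => /andP[].
      by rewrite !restrM // => tm; rewrite tm mC in tauC.
    + apply/negP=> /imset2P[m r mT rL]; rewrite -[alpha :|: tau]setU0 => h.
      have := congr1 (fun t => t :&: SM) h.
      have mM : m \in M by have := subsetP TD _ mT; rewrite inE => /andP[].
      by rewrite !restrM // => tm; rewrite tm !inE eqxx in mT.
  - exact: edge_connectS qp.
  exact: IHn.
have -> : Cur :|: [set alpha :|: m :|: r | m : {set V} in M, r : {set V} in L] =
    Cur :|: J C :|: J (M :\: C).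
  rewrite -[RHS]setUA; congr (_ :|: _); apply/setP=> t; rewrite in_setU.
  apply/imset2P/orP => [[m r mM rL ->]|[]/imset2P[m r + rL ->]].
  - have [mC|mC] := boolP (m \in C); [left|right]; apply/imset2P.
      by exists m r.
    by exists m r; rewrite // inE mC.
  - by rewrite inE => /andP[mM _]; exists m r.
  by rewrite inE => /andP[_ mM]; exists m r.
exact: H.
Qed.

End AttachApex.
End AttachJoin.

(** * Polyhedral joins over a forest *)

Lemma wedgelike_cone (V : finType) (K : {set {set V}}) (q : V) :
  complex K -> [set q] \in K -> (forall t, t \in K -> q |: t \in K) ->
  wedgelike K q.
Proof.
move=> cK qK coneK; pose A := powerset [set q].
have cA : complex A.
  by move=> s t ts; rewrite !inE; exact: subset_trans.
have AK : A \subset K.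
  by apply/subsetP=> t; rewrite inE => tq; exact: cK tq qK.
have qA : [set q] \in A by rewrite inE.
apply: (@wedgelike_simple_equiv _ _ A q).
  apply/simple_equiv_sym/texp_simple_equiv => //; apply: (@texp_toggle _ q); split=> // t tK tA.
  split; first exact: coneK.
  apply: contra tA; rewrite !inE => tq; apply/subsetP=> x xt; rewrite inE.
  by have [//|xq] := eqVneq x q; have := subsetP tq x; rewrite !inE (negbTE xq) xt => /(_ isT).
(* Without any lobe [std] is the single vertex [None]. *)
exists void, (fun _ => 0); pose f (x : std_vertex (fun _ : void => 0)) : V :=
  if x is Some (existT i _) then match i with end else q.
have f_inj : injective f by move=> [[[] ?]|] // [[[] ?]|].
apply: simple_equiv_sym; suff -> : A = [set f @: s | s : {set _} in std (fun _ : void => 0)].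
  exact: (simple_equiv_rename _ None f_inj).
apply/setP=> t; rewrite mem_imset_complex // inE.
have -> : f @: setT = [set q].
  apply/setP=> x; rewrite inE; apply/imsetP/eqP => [[[[[] ?]|] _ ->]//|->].
  by exists None.
rewrite -[LHS]andbT; congr (_ && _); apply/esym; rewrite inE; apply/orP; left.
by apply/subsetP=> -[[[] ?]|]; rewrite !inE.
Qed.

Section PolyhedralJoin.
Variables (G : finType) (adj : rel G).
Hypotheses (adj_sym : symmetric adj) (adj_irr : irreflexive adj).
Variables (A : finType) (M : {set {set A}}).
Implicit Types (U : {set G}) (v w : G) (m r t c e : {set G * A}).

Definition fiber w t : {set A} := pair w @^-1: t.
Definition lying_over U : {set G * A} := [set x | x.1 \in U].
Definition copy w : {set {set G * A}} := [set pair w @: s | s : {set A} in M].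
(** In the notation of the overview this is [Z(U)]; [copy w] is [N_w], and [far w U] is what remains
    of [U] outside the closed neighborhood of [w]. *)
Definition indep_join U : {set {set G * A}} :=
  [set t : {set G * A} | [&& t \subset lying_over U, [forall x in t, forall y in t, ~~ adj x.1 y.1]
             & [forall w, fiber w t \in M]]].
Definition far w U : {set G} := [set x in U | (x != w) && ~~ adj w x].

Hypothesis cM : complex M.
Hypothesis M0 : set0 \in M.

Let pair_inj w : injective (@pair G A w). Proof. by move=> x y []. Qed.

Lemma copyP w t : (t \in copy w) = (t \subset lying_over [set w]) && (fiber w t \in M).
Proof.
rewrite mem_imset_complex //; congr (_ && _).
suff -> : pair w @: [set: A] = lying_over [set w] by [].
apply/setP=> -[x a]; rewrite !inE /=; apply/imsetP/eqP => [[b _ [->]]//|->].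
by exists a.
Qed.

Lemma fiber_over w v t : w != v -> t \subset lying_over [set v] -> fiber w t = set0.
Proof.
move=> wv /subsetP tv; apply/setP=> a; rewrite !inE; apply/negP=> /tv.
by rewrite !inE (negbTE wv).
Qed.

Lemma fiberU w t t' : fiber w (t :|: t') = fiber w t :|: fiber w t'.
Proof. by apply/setP=> a; rewrite !inE. Qed.

Lemma complex_copy w : complex (copy w).
Proof.
move=> s t ts; rewrite !copyP => /andP[sw sM]; rewrite (subset_trans ts sw) /=.
by apply: cM sM; exact: preimsetS.
Qed.

Lemma complex_indep_join U : complex (indep_join U).
Proof.
move=> s t ts; rewrite !inE => /and3P[sU /forall_inP si /forallP sM].
rewrite (subset_trans ts sU) /=; apply/andP; split.
  apply/forall_inP=> x xt; apply/forall_inP=> y yt.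
  by apply: (forall_inP (si x _)); exact: (subsetP ts).
by apply/forallP=> w; apply: cM (sM w); exact: preimsetS.
Qed.

Lemma indep_join_set0 U : set0 \in indep_join U.
Proof.
rewrite inE sub0set /=; apply/andP; split.
  by apply/forall_inP=> x; rewrite inE.
by apply/forallP=> w; rewrite (_ : fiber w _ = set0) //; apply/setP=> a; rewrite !inE.
Qed.

Lemma indep_join_over U t : t \in indep_join U -> t \subset lying_over U.
Proof. by rewrite inE => /andP[]. Qed.

Lemma indep_joinS U U' : U' \subset U -> indep_join U' \subset indep_join U.
Proof.
move=> U'U; apply/subsetP=> t; rewrite !inE => /andP[tU ->]; rewrite andbT.
by apply: subset_trans tU _; apply/subsetP=> x; rewrite !inE; exact: subsetP.
Qed.

Lemma indep_join_copy w U m : w \in U -> m \in copy w -> m \in indep_join U.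
Proof.
move=> wU; rewrite copyP => /andP[mw mM].
have m1 x : x \in m -> x.1 = w by move=> /(subsetP mw); rewrite !inE => /eqP.
rewrite inE; apply/and3P; split.
- by apply/subsetP=> x xm; rewrite inE (m1 x xm).
- by apply/forall_inP=> x /m1 ->; apply/forall_inP=> y /m1 ->; rewrite adj_irr.
by apply/forallP=> v; have [->//|vw] := eqVneq v w; rewrite (fiber_over vw mw).
Qed.

Lemma indep_join_cup w U m r : w \in U -> m \in copy w ->
  r \in indep_join (far w U) -> m :|: r \in indep_join U.
Proof.
move=> wU mw rU; have := indep_join_copy wU mw.
have UU : far w U \subset U by apply/subsetP=> x; rewrite inE => /andP[].
have := subsetP (indep_joinS UU) _ rU.
rewrite !inE => /and3P[rU' /forall_inP ri /forallP rM] /and3P[mU /forall_inP mi /forallP mM].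
have := mw; rewrite copyP => /andP[mw' _].
have m1 x : x \in m -> x.1 = w by move=> /(subsetP mw'); rewrite !inE => /eqP.
have r1 y : y \in r -> y.1 != w /\ ~~ adj w y.1.
  by move=> /(subsetP (indep_join_over rU)); rewrite !inE => /and3P[].
apply/and3P; split.
- by rewrite subUset mU.
- apply/forall_inP=> x xmr; apply/forall_inP=> y.
  move: xmr; rewrite !inE => /orP[xm|xr] /orP[ym|yr].
  + exact: (forall_inP (mi x xm)).
  + by rewrite (m1 x xm); have [] := r1 y yr.
  + by rewrite (m1 y ym) adj_sym; have [] := r1 x xr.
  exact: (forall_inP (ri x xr)).
apply/forallP=> v; rewrite fiberU; have [->|vw] := eqVneq v w; last first.
  by rewrite (fiber_over vw mw') set0U.
suff -> : fiber w r = set0 by rewrite setU0.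
by apply/setP=> a; rewrite !inE; apply/negP=> /r1; rewrite eqxx => -[].
Qed.

(** Together with [indep_join_cup] this is the decomposition of [Z(U)] along [w], according to
    whether the fiber over [w] is empty. *)
Lemma indep_join_split w U t : t \in indep_join U -> t \in indep_join (U :\ w) \/
  exists2 m, m \in copy w & exists2 r, r \in indep_join (far w U) & t = m :|: r.
Proof.
move=> tU; have := tU; rewrite inE => /and3P[tU' /forall_inP ti /forallP tM].
have [fw|/set0Pn[a]] := eqVneq (fiber w t) set0.
  left; rewrite inE; apply/and3P; split; [|exact/forall_inP|exact/forallP].
  apply/subsetP=> -[x a] xt; have := subsetP tU' _ xt; rewrite !inE /= => ->.
  by rewrite andbT; apply: contraTneq xt => ->; have := in_set0 a; rewrite -fw inE => ->.
rewrite inE => wat; right; exists (t :&: lying_over [set w]); last first.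
  exists (t :\: lying_over [set w]); last by rewrite setID.
  have : t :\: lying_over [set w] \in indep_join U.
    by apply: complex_indep_join tU; exact: subsetDl.
  rewrite inE => /and3P[_ h1 h2]; rewrite inE h1 h2 /= andbT.
  apply/subsetP=> x; rewrite !inE => /andP[xw xt]; rewrite xw /=.
  have := subsetP tU' _ xt; rewrite inE => -> /=.
  by have := forall_inP (ti _ wat) _ xt.
rewrite copyP subsetIr (_ : fiber w _ = fiber w t) ?tM //.
by apply/setP=> b; rewrite !inE eqxx andbT.
Qed.

Lemma indep_join0 : indep_join set0 = [set set0].
Proof.
apply/setP=> t; rewrite [RHS]inE; apply/idP/eqP => [/indep_join_over/subsetP h|->].
  by apply/setP=> x; rewrite [RHS]inE; apply/negP=> /h; rewrite !inE.
exact: indep_join_set0.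
Qed.

Lemma over_disjoint U U' : [disjoint U & U'] -> [disjoint lying_over U & lying_over U'].
Proof.
move=> d; rewrite disjoints_subset; apply/subsetP=> x; rewrite !inE => xU.
by rewrite (disjointFr d xU).
Qed.

Variable q : A.
Hypothesis qM : [set q] \in M.
Hypothesis M_apex : forall s : {set A}, s \in M -> q |: s \notin M ->
  forall c : {set A}, c \proper s -> q |: c \in M.

Lemma copy_apex w : [set (w, q)] \in copy w.
Proof.
apply/imsetP; exists [set q] => //.
by apply/setP=> x; rewrite imset_set1.
Qed.

Lemma copy_apexP w m : m \in copy w -> (w, q) |: m \notin copy w ->
  forall c : {set G * A}, c \proper m -> (w, q) |: c \in copy w.
Proof.
move=> /imsetP[s sM ->]; rewrite -imsetU1 => qs c cs.
have cE : c = pair w @: (fiber w c).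
  apply/setP=> x; apply/idP/imsetP => [xc|[a]]; last by rewrite inE => ac ->.
  have /imsetP[a _ xE] := subsetP (proper_sub cs) _ xc.
  by exists a => //; rewrite inE -xE.
rewrite cE -imsetU1 imset_f //; apply: (M_apex sM).
  by apply: contra qs => qs; rewrite imset_f.
have [c1 [x /imsetP[a aM xE] xc]] := properP cs; apply/properP; split.
  apply/subsetP=> b; rewrite inE => /(subsetP c1) /imsetP[b' b'M [->]] //.
by exists a; rewrite // inE -xE.
Qed.

Lemma copy_over w m : m \in copy w -> m \subset lying_over [set w].
Proof. by rewrite copyP => /andP[]. Qed.

Lemma copy_sub1 w c : c \subset [set (w, q)] -> c \in copy w.
Proof. by move=> h; apply: complex_copy h (copy_apex w). Qed.

Section Extend.
Variables (U : {set G}) (Cur E : {set {set G * A}}) (alpha : {set G * A}) (p : G * A).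
Hypotheses (cCur : complex Cur) (alCur : alpha \notin Cur).
Hypothesis (al_U : [disjoint alpha & lying_over U]).
Hypothesis (E_U : forall e, e \in E -> [disjoint e & lying_over U]).
Hypothesis (dal : forall c : {set G * A}, c \proper alpha -> c \in E) .
Hypothesis (tE : texp set0 E).
Hypothesis (ECur : forall e r, e \in E -> r \in indep_join U -> e :|: r \in Cur).

Let overS (U1 : {set G}) : U1 \subset U -> lying_over U1 \subset lying_over U.
Proof. by move=> h; apply/subsetP=> x; rewrite !inE; exact: subsetP. Qed.

Let al_over U1 : U1 \subset U -> [disjoint alpha & lying_over U1].
Proof. by move=> h; apply: disjointWr al_U; exact: overS. Qed.

Let E_over U1 e : U1 \subset U -> e \in E -> [disjoint e & lying_over U1].
Proof. by move=> h /E_U; apply: disjointWr; exact: overS. Qed.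

Let alUCur r : alpha :|: r \notin Cur.
Proof. by apply: contra alCur; apply: cCur; exact: subsetUl. Qed.

Definition cone_join v : {set {set G * A}} :=
  [set c :|: r | c : {set _} in powerset [set (v, q)], r : {set _} in indep_join (U :\ v)].

Lemma complex_cone_join v : complex (cone_join v).
Proof.
move=> s t ts /imset2P[c r]; rewrite inE => cq rU sE; apply/imset2P.
exists (t :&: c) (t :&: r).
- by rewrite inE; apply: subset_trans cq; exact: subsetIr.
- by apply: complex_indep_join rU; exact: subsetIr.
by rewrite -setIUr -sE; apply/esym/setIidPl.
Qed.

Lemma cone_join_apex v t : t \in cone_join v -> (v, q) |: t \in cone_join v.
Proof.
move=> /imset2P[c r]; rewrite inE => cq rU ->; rewrite setUA imset2_f //.
by rewrite inE subUset subxx.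
Qed.

(** For an isolated [v] the set [far v U] is [U :\ v], so [Z(U)] is the join of [N_v] and
    [Z(U :\ v)], and the cone with tip [(v, q)] is the part to start from. *)
Lemma wedgelike_isolated v (Cur1 := Cur :|: [set alpha :|: t | t : {set _} in cone_join v]) :
  v \in U -> (forall x, x \in U -> ~~ adj v x) ->
  attachable (lying_over (U :\ v)) (indep_join (U :\ v)) ->
  complex Cur1 -> [set p] \in Cur1 -> edge_connect Cur1 (v, q) p ->
  wedgelike Cur1 p ->
  wedgelike (Cur :|: [set alpha :|: r | r : {set _} in indep_join U]) p.
Proof.
move=> vU vadj att cCur1 pCur1 vp w1.
have farE : far v U = U :\ v.
  by apply/setP=> x; rewrite !inE andbC; case xU: (x \in U); rewrite ?andbF ?vadj ?andbT.
have vU1 : [set v] \subset U by rewrite sub1set.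
have UU : U :\ v \subset U by exact: subD1set.
have SS : [disjoint lying_over [set v] & lying_over (U :\ v)].
  by apply: over_disjoint; rewrite disjoints1 !inE eqxx.
have := @wedgelike_attach_apex _ (copy v) (indep_join (U :\ v)) (lying_over [set v])
  (lying_over (U :\ v)) (v, q) (@complex_copy v) (copy_apex v) (@copy_over v) (@copy_apexP v)
  (@complex_indep_join _) (indep_join_set0 _) (@indep_join_over _) SS att
  Cur1 E alpha p cCur1 pCur1 dal tE (al_over vU1) (al_over UU)
  (fun e => E_over vU1) (fun e => E_over UU).
have -> : Cur1 :|: [set alpha :|: m :|: r | m : {set _} in copy v,
      r : {set _} in indep_join (U :\ v)] =
    Cur :|: [set alpha :|: r | r : {set _} in indep_join U].
  rewrite -setUA; congr (_ :|: _); apply/setP=> t; rewrite in_setU.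
  apply/orP/imsetP => [[/imsetP[_ /imset2P[c r + rU ->] ->]|/imset2P[m r mv rU ->]]|[t' t'U ->]].
  - rewrite inE => /copy_sub1 cv; exists (c :|: r) => //.
    by apply: indep_join_cup cv _; rewrite ?farE.
  - exists (m :|: r); last by rewrite setUA.
    by apply: indep_join_cup mv _; rewrite ?farE.
  case: (indep_join_split v t'U) => [h|[m mv [r]]].
    right; apply/imset2P; exists set0 t' => //; last by rewrite setU0.
    by apply: copy_sub1; exact: sub0set.
  by rewrite farE => rU ->; right; apply/imset2P; exists m r => //; rewrite setUA.
apply=> //.
- move=> e m r eE mv rU; rewrite -setUA inE ECur //.
  by apply: indep_join_cup mv _; rewrite ?farE.
- move=> r rU; rewrite inE; apply/orP; right; apply/imsetP; exists ([set (v, q)] :|: r).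
    by rewrite imset2_f // inE.
  by rewrite setUA.
move=> m mv mq; rewrite !inE negb_or alUCur /=.
apply/negP=> /imsetP[_ /imset2P[c r + rU ->]]; rewrite inE => cq h.
case/negP: mq; apply/subsetP=> x xm; have := congr1 (fun t => x \in t) h; rewrite !inE xm orbT.
have xv := subsetP (copy_over mv) _ xm.
have -> : x \in alpha = false.
  by apply: disjointFl (al_over vU1) xv.
have -> : x \in r = false.
  by apply/negP=> /(subsetP (indep_join_over rU)); rewrite (disjointFr SS xv).
by rewrite orbF /= => /esym/(subsetP cq); rewrite inE.
Qed.

(** The tip [(v, q)] is used for the passage from [Cur1] to [Cur2], the tip [(w, q)] afterwards. The
    latter may become connected to [p] only in [Cur2], hence the two separate connectivity
    hypotheses. *)
Lemma wedgelike_leaf v w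
    (Cur1 := Cur :|: [set alpha :|: r | r : {set _} in indep_join (U :\ w)])
    (Cur2 := Cur1 :|: [set alpha :|: [set (w, q)] :|: r | r : {set _} in indep_join (far w U)]) :
  v \in U -> w \in U -> adj v w -> (forall x, x \in U -> adj v x -> x = w) ->
  attachable (lying_over (far w U)) (indep_join (far w U)) ->
  [set p] \in Cur1 -> edge_connect Cur1 (v, q) p -> edge_connect Cur2 (w, q) p ->
  wedgelike Cur1 p ->
  wedgelike (Cur :|: [set alpha :|: r | r : {set _} in indep_join U]) p.
Proof.
move=> vU wU vw vadj att pCur1 vp wp w1.
have v_w : v != w by apply: contraTneq vw => ->; rewrite adj_irr.
have wU1 : [set w] \subset U by rewrite sub1set.
have UU : far w U \subset U by apply/subsetP=> x; rewrite inE => /andP[].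
have SS : [disjoint lying_over [set w] & lying_over (far w U)].
  by apply: over_disjoint; rewrite disjoints1 !inE eqxx andbF.
have cCur1 : complex Cur1.
  apply: complex_join => //; first exact: complex_indep_join.
  move=> c r /dal cE rU; apply: ECur => //.
  by apply: subsetP rU; apply: indep_joinS; exact: subD1set.
have Cur1S : Cur \subset Cur1 by exact: subsetUl.
(* Since [w] is the only neighbor of [v] in [U], no vertex of [far w U] is adjacent to [v]: this is
   why [L] spans a cone with tip [(v, q)] in [Z(U :\ w)]. *)
have vfar : indep_join (far w U) \subset indep_join (far v (U :\ w)).
  apply: indep_joinS; apply/subsetP=> x; rewrite !inE => /and3P[xU xw wx].
  rewrite xw xU /=; apply/andP; split.
    by apply: contraNneq wx => ->; rewrite adj_sym.
  by apply: contra xw => /(vadj _ xU) ->.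
have q1 e c r : e \in alpha |: E -> c :\ (v, q) \proper [set (w, q)] ->
    r \in indep_join (far w U) -> e :|: c :|: r \in Cur1.
  move=> eE cq rU; have cv : c \in copy v.
    apply: copy_sub1; rewrite -setD_eq0.
    by move: cq; rewrite properEneq subset1 => /andP[/negbTE -> /=].
  have cr : c :|: r \in indep_join (U :\ w).
    apply: (indep_join_cup _ cv); first by rewrite !inE v_w.
    exact: (subsetP vfar).
  rewrite -setUA; move: eE; rewrite in_setU1 => /orP[/eqP->|eE].
    by rewrite inE imset_f ?orbT.
  apply: (subsetP Cur1S); apply: ECur => //.
  by apply: subsetP cr; apply: indep_joinS; exact: subD1set.
have q2 e r : e \in E -> r \in indep_join (far w U) -> [set (w, q)] :|: e :|: r \in Cur1.
  move=> eE rU; rewrite [[set _] :|: e]setUC -setUA; apply: (subsetP Cur1S).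
  by apply: ECur => //; apply: indep_join_cup rU => //; exact: copy_apex.
have cCur2 : complex Cur2.
  exact: (complex_attach_step dal cCur1 (@complex_indep_join _) q1 q2).
have wq_al : (w, q) \notin alpha.
  by apply/negP=> h; have := disjointFr al_U h; rewrite inE wU.
have w2 : wedgelike Cur2 p.
  (* Here [tau] is the single vertex [(w, q)], with empty boundary, so the sets [c] allowed in the
     step are the empty set and the tip [(v, q)]. *)
  apply: (@wedgelike_attach_step _ alpha [set (w, q)] E (v, q) dal tE _ _ _ _
    (lying_over (far w U)) (indep_join (far w U)) Cur1 p) => //.
  - by apply/set0Pn; exists (w, q); rewrite inE.
  - by rewrite inE; apply: contra v_w => /eqP[->].
  - by rewrite disjoints1.
  - move=> e /E_U h; rewrite disjoints1; apply/negP=> h'.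
    by have := disjointFr h h'; rewrite inE wU.
  - exact: al_over.
  - by move=> e; exact: E_over.
  - by rewrite disjoints1 !inE eqxx andbF.
  - by rewrite !inE adj_sym vw !andbF.
  rewrite in_setU negb_or alUCur /=; apply/negP=> /imsetP[r rU h].
  have := congr1 (fun t => (w, q) \in t) h; rewrite !inE eqxx orbT (negbTE wq_al) /=.
  by move=> /esym/(subsetP (indep_join_over rU)); rewrite !inE eqxx.
have := @wedgelike_attach_apex _ (copy w) (indep_join (far w U)) (lying_over [set w])
  (lying_over (far w U)) (w, q) (@complex_copy w) (copy_apex w) (@copy_over w) (@copy_apexP w)
  (@complex_indep_join _) (indep_join_set0 _) (@indep_join_over _) SS att
  Cur2 E alpha p cCur2 _ dal tE (al_over wU1) (al_over UU)
  (fun e => E_over wU1) (fun e => E_over UU).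
have -> : Cur2 :|: [set alpha :|: m :|: r | m : {set _} in copy w,
      r : {set _} in indep_join (far w U)] =
    Cur :|: [set alpha :|: r | r : {set _} in indep_join U].
  rewrite /Cur2 /Cur1 -!setUA; congr (_ :|: _); apply/setP=> t; rewrite !in_setU.
  apply/or3P/imsetP => [[/imsetP[r rU ->]|/imsetP[r rU ->]|/imset2P[m r mw rU ->]]|[t' t'U ->]].
  - by exists r => //; apply: subsetP rU; apply: indep_joinS; exact: subD1set.
  - exists ([set (w, q)] :|: r); last by rewrite setUA.
    by apply: indep_join_cup rU => //; exact: copy_apex.
  - by exists (m :|: r); rewrite ?setUA // (indep_join_cup wU).
  case: (indep_join_split w t'U) => [h|[m mv [r rU ->]]].
    by apply: Or31; apply/imsetP; exists t'.
  by apply: Or33; apply/imset2P; exists m r => //; rewrite setUA.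
have Cur2S : Cur1 \subset Cur2 by exact: subsetUl.
apply=> //.
- exact: (subsetP Cur2S).
- move=> e m r eE mw rU; rewrite -setUA; apply/(subsetP Cur2S)/(subsetP Cur1S)/ECur => //.
  exact: indep_join_cup mw rU.
- by move=> r rU; rewrite inE imset_f ?orbT.
move=> m mw mq; rewrite !in_setU !negb_or alUCur /=.
have mw' x : x \in m -> x \in lying_over [set w] /\ x \notin alpha.
  move=> /(subsetP (copy_over mw)) xw; split=> //.
  by rewrite (disjointFl (al_over wU1) xw).
apply/andP; split; apply/negP=> /imsetP[r rU h].
  case/negP: mq; suff -> : m = set0 by exact: sub0set.
  apply/setP=> x; rewrite [RHS]inE; apply/negP=> xm.
  have [xw xal] := mw' x xm; have := congr1 (fun t => x \in t) h.
  rewrite !inE xm (negbTE xal) /= => /esym/(subsetP (indep_join_over rU)).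
  by move: xw; rewrite !inE => ->.
case/negP: mq; apply/subsetP=> x xm.
have [xw xal] := mw' x xm; have := congr1 (fun t => x \in t) h.
rewrite in_setU [RHS]in_setU in_setU xm (negbTE xal) /= => /esym/orP[//|].
by move=> /(subsetP (indep_join_over rU)); rewrite (disjointFr SS xw).
Qed.

End Extend.

(** 1-degeneracy is the form in which the forest enters. It speaks of all vertex sets because the
    induction passes to induced subgraphs. *)
Hypothesis degenerate : forall U, U != set0 ->
  exists2 v, v \in U & #|[set w in U | adj v w]| <= 1.

Lemma degenerateP U : U != set0 -> exists2 v, v \in U &
  (forall x, x \in U -> ~~ adj v x) \/
  (exists2 w, w \in U & adj v w /\ forall x, x \in U -> adj v x -> x = w).
Proof.
move=> /degenerate[v vU]; rewrite leq_eqVlt ltnS leqn0 => h; exists v => //.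
case/orP: h => [/cards1P[w wE]|h0]; [right|left].
  have hw x : (x \in U) && adj v x = (x == w).
    by have := congr1 (fun t : {set G} => x \in t) wE; rewrite !inE.
  have /andP[wU vw] : (w \in U) && adj v w by rewrite hw.
  by exists w => //; split=> // x xU vx; apply/eqP; rewrite -hw xU.
rewrite cards_eq0 in h0; move=> x xU; apply/negP=> vx.
by have := in_set0 x; rewrite -(eqP h0) !inE xU vx.
Qed.

(** Induction on the size of [U]. At a leaf the induction hypothesis serves twice: for [U :\ w],
    with the same [alpha] and [E], and for [far w U], where [wedgelike_leaf] enlarges [alpha]. *)
Lemma attachable_indep_join U : attachable (lying_over U) (indep_join U).
Proof.
have [n] := ubnP #|U|; elim: n U => // n IHn U leU.
have [->|U0] := eqVneq U set0; first by rewrite indep_join0; exact: attachable0.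
have [v vU adjv] := degenerateP U0.
have ltU (U' : {set G}) x : U' \subset U -> x \in U -> x \notin U' -> #|U'| < n.
  move=> U'U xU xU'; rewrite ltnS in leU; apply: (leq_trans _ leU); apply: proper_card.
  by apply/properP; split=> //; exists x.
move=> Cur alpha E p u cCur pCur al0 alU EU dal tE ECur alCur uE up wCur.
(* The edge from [u] to [(w, q)] belongs to [E * Z(U)], so all tips are connected to the base point
   within [Cur]. *)
have edge w : w \in U -> edge_connect Cur (w, q) p.
  move=> wU; apply: connect_trans up; apply: connect1.
  rewrite setUC; apply: ECur => //; apply: (indep_join_copy wU); exact: copy_apex.
have EN U1 : U1 \subset U ->
    forall e r, e \in E -> r \in indep_join U1 -> e :|: r \in Cur.
  by move=> h e r eE rU; apply: ECur => //; apply: subsetP rU; exact: indep_joinS.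
case: adjv => [adjv|[w wU [vw adjv]]].
  have NU : cone_join U v \subset indep_join U.
    apply/subsetP=> t /imset2P[c r]; rewrite inE => /copy_sub1 cv rU ->.
    apply: (indep_join_cup vU cv); apply: subsetP rU; apply: indep_joinS.
    by apply/subsetP=> x; rewrite !inE => /andP[-> xU]; rewrite xU adjv.
  (* A cone is collapsible, so its join with [alpha] is added to [Cur] by expansions, and the wedge
     type does not change. *)
  have tN : texp Cur (Cur :|: [set alpha :|: t | t : {set _} in cone_join U v]).
    apply: texp_join => //.
    - apply: (@texp_toggle _ (v, q)); split; rewrite ?sub0set //.
      + exact: complex0.
      + exact: complex_cone_join.
      by move=> t /cone_join_apex h _; rewrite inE.
    - by move=> c e /dal cE eN; apply: ECur => //; exact: (subsetP NU).
    move=> e /(subsetP NU) /indep_join_over eU; split; first exact: disjointWr eU alU.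
    by apply: contra alCur; apply: cCur; exact: subsetUl.
  apply: (wedgelike_isolated cCur alCur alU EU dal tE ECur vU adjv).
  - by apply/IHn/(ltU _ v); rewrite ?subD1set // !inE eqxx.
  - by have [] := texp_complex tN.
  - by rewrite inE pCur.
  - by apply: edge_connectS (edge v vU); exact: subsetUl.
  by apply: wedgelike_simple_equiv wCur; apply/simple_equiv_sym/texp_simple_equiv.
have UwU : U :\ w \subset U by exact: subD1set.
have farU : far w U \subset U by apply/subsetP=> x; rewrite inE => /andP[].
apply: (wedgelike_leaf cCur alCur alU EU dal tE ECur vU wU vw adjv).
- by apply/IHn/(ltU _ w); rewrite // !inE eqxx andbF.
- by rewrite inE pCur.
- by apply: edge_connectS (edge v vU); exact: subsetUl.
- by apply: edge_connectS (edge w wU); rewrite -setUA; exact: subsetUl.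
apply: (IHn _ (ltU _ w UwU wU _) _ _ E _ u) => //.
- by rewrite !inE eqxx.
- apply: disjointWr alU; apply/subsetP=> x; rewrite !inE => /andP[//].
- move=> e /EU; apply: disjointWr; apply/subsetP=> x; rewrite !inE => /andP[//].
exact: EN.
Qed.

(** The outermost level: with [alpha] empty and [Cur], [E] void, attaching [alpha * Z(U)] means
    building [Z(U)] from nothing, beginning with a cone. *)
Lemma wedgelike_indep_join_isolated U v : v \in U ->
  (forall x, x \in U -> ~~ adj v x) -> wedgelike (indep_join U) (v, q).
Proof.
move=> vU adjv.
have im0 (K : {set {set G * A}}) : set0 :|: [set set0 :|: t | t : {set _} in K] = K.
  rewrite set0U -[RHS]imset_id; apply: eq_imset => t; exact: set0U.
have d0 (X : {set G * A}) : [disjoint (set0 : {set G * A}) & X].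
  by rewrite disjoints_subset sub0set.
rewrite -(im0 (indep_join U)).
apply: (@wedgelike_isolated U set0 set0 set0 (v, q) _ _ _ _ _ _ _ v vU adjv).
- exact: complex0.
- by rewrite inE.
- exact: d0.
- by move=> e; rewrite inE.
- by move=> c /properP[_ [x]]; rewrite inE.
- exact/texp_refl/complex0.
- by move=> e r; rewrite inE.
- exact: attachable_indep_join.
- rewrite im0; exact: complex_cone_join.
- rewrite im0; apply/imset2P; exists [set (v, q)] set0;
    [by rewrite inE|exact: indep_join_set0|by rewrite setU0].
- exact: connect0.
rewrite im0; apply: wedgelike_cone.
- exact: complex_cone_join.
- apply/imset2P; exists [set (v, q)] set0;
    [by rewrite inE|exact: indep_join_set0|by rewrite setU0].
exact: cone_join_apex.
Qed.

Lemma wedgelike_indep_join : 0 < #|G| ->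
  (forall u, exists2 v, v != u & ~~ adj u v) ->
  exists p, wedgelike (indep_join [set: G]) p.
Proof.
move=> G0 nodom; have /degenerateP[v _ adjv] : [set: G] != set0.
  by rewrite -card_gt0 cardsT.
exists (v, q); case: adjv => [adjv|[w _ [vw adjv]]].
  exact: wedgelike_indep_join_isolated.
have v_w : v != w by apply: contraTneq vw => ->; rewrite adj_irr.
have im0 (K : {set {set G * A}}) : set0 :|: [set set0 :|: t | t : {set _} in K] = K.
  rewrite set0U -[RHS]imset_id; apply: eq_imset => t; exact: set0U.
have d0 (X : {set G * A}) : [disjoint (set0 : {set G * A}) & X].
  by rewrite disjoints_subset sub0set.
rewrite -(im0 (indep_join setT)).
have vI : v \in [set: G] :\ w by rewrite !inE v_w.
have [x xw wx] := nodom w.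
have pair_in U y z : y \in U -> z \in U -> y != z -> ~~ adj y z ->
    [set (y, q); (z, q)] \in indep_join U.
  move=> yU zU yz ayz; apply: (indep_join_cup yU (copy_apex y)).
  by apply: indep_join_copy (copy_apex z); rewrite !inE zU eq_sym yz.
have vx : ~~ adj v x by apply: contra xw => /adjv ->.
apply: (@wedgelike_leaf setT set0 set0 set0 (v, q) _ _ _ _ _ _ _ v w) => //.
- exact: complex0.
- by rewrite inE.
- by move=> e; rewrite inE.
- by move=> c /properP[_ [y]]; rewrite inE.
- exact/texp_refl/complex0.
- by move=> e r; rewrite inE.
- exact: attachable_indep_join.
- rewrite im0; exact: indep_join_copy vI (copy_apex v).
- exact: connect0.
(* The vertex [x], not dominated by [w], lies in [far w], which gives the edge to [(w, q)]; it is
   not adjacent to [v], whose only neighbor is [w], which gives the edge to [(v, q)]. *)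
- apply: (connect_trans (y := (x, q))); apply: connect1.
    rewrite inE; apply/orP; right; apply/imsetP; exists [set (x, q)]; last by rewrite set0U.
    by apply: indep_join_copy (copy_apex x); rewrite !inE xw wx.
  rewrite im0 inE; apply/orP; left; apply: pair_in; rewrite ?inE ?xw ?v_w //.
    by apply: contraTneq vw => <-; rewrite adj_sym.
  by rewrite adj_sym.
(* Removing [w] isolates the leaf [v], so the isolated case applies to the rest, with the same base
   point. *)
rewrite im0; apply: wedgelike_indep_join_isolated => // y; rewrite !inE andbT => yw.
by apply: contra yw => /adjv ->.
Qed.

End PolyhedralJoin.

(** * Induced cycles from minimum degree two *)

Section Forest.
Variables (G : finType) (adj : rel G).
Hypotheses (adj_sym : symmetric adj) (adj_irr : irreflexive adj).
Variable U : {set G}.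

(** Among the later vertices each vertex is adjacent exactly to its successor. The default of [head]
    is harmless, since [all] is vacuous on the empty sequence. *)
Fixpoint induced_path (s : seq G) : bool :=
  if s is x :: s' then
    [&& x \in U, x \notin s', all (fun y => adj x y == (y == head x s')) s'
      & induced_path s']
  else true.

Lemma induced_path_uniq s : induced_path s -> uniq s.
Proof. by elim: s => //= x s IH /and4P[_ -> _ /IH ->]. Qed.

Lemma induced_path_nth x0 s i k : induced_path s -> i < k < size s ->
  adj (nth x0 s i) (nth x0 s k) = (k == i.+1).
Proof.
elim: s i k => [|x s IH] i k /=; first by rewrite ltn0 andbF.
move=> /and4P[_ _ /allP adjx ps] /andP[ik ks].
case: k ik ks => // k ik ks; case: i ik => [_|i ik] /=; last first.
  by rewrite IH //; apply/andP.
rewrite (eqP (adjx _ (mem_nth x0 ks))) eqSS.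
have us := induced_path_uniq ps.
case: s ks us {IH adjx ps} => //= y s ks us.
by rewrite -[y in LHS]/(nth x0 (y :: s) 0) nth_uniq.
Qed.

(* An end [x] of a longest induced path has a neighbor [y] other than its successor;
   as [y] does not extend the path, it has another neighbor on it, and the first
   such neighbor closes an induced cycle. *)
Lemma induced_cycle : U != set0 ->
  (forall v, v \in U -> 1 < #|[set w in U | adj v w]|) ->
  exists n, exists2 f : 'I_n.+3 -> G, injective f &
    forall i j, adj (f i) (f j) = (j == ordS i) || (i == ordS j).
Proof.
move=> /set0Pn[x0 x0U] deg.
pose P n := [exists t : n.-tuple G, induced_path t].
have P1 : exists n, P n by exists 1; apply/existsP; exists [tuple x0]; rewrite /= x0U.
have Pmax n : P n -> n <= #|G|.
  by case/existsP=> t /induced_path_uniq/card_uniqP h; rewrite -(size_tuple t) -h max_card.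
case: (ex_maxnP P1 Pmax) => n /existsP[t pt] nmax.
have pmax s : induced_path s -> size s <= size t.
  move=> ps; rewrite size_tuple; apply: nmax; apply/existsP; exists (in_tuple s).
  exact: ps.
case: {nmax}(tval t) pt pmax => [|x s] pt pmax.
  by have := pmax [:: x0]; rewrite /= x0U => /(_ isT).
(* Two neighbors leave one after discarding the successor. If [s] is empty, the default [x] of
   [head] is not a neighbor of [x], and discarding it costs nothing. *)
have [y yU /andP[xy yh]] : exists2 y, y \in U & adj x y && (y != head x s).
  have xU : x \in U by case/andP: pt.
  have := deg x xU; rewrite (cardsD1 (head x s)); case: (_ \in _) => /=.
    rewrite add1n ltnS => /card_gt0P[y]; rewrite !inE => /and3P[h yU xy].
    by exists y => //; rewrite xy.
  rewrite add0n => /ltnW/card_gt0P[y]; rewrite !inE => /and3P[h yU xy].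
  by exists y => //; rewrite xy.
have ys : y \notin s.
  move: pt => /and4P[_ _ /allP h _]; apply/negP=> /h.
  by rewrite xy (negbTE yh).
have yx : y != x by apply: contraTneq xy => ->; rewrite adj_irr.
have hs : has (adj y) s.
  apply: contraT => /hasPn h; suff /pmax : induced_path [:: y, x & s].
    by rewrite /= ltnn.
  rewrite /= yU inE negb_or yx ys /= adj_sym xy eqxx; apply/andP; split=> //.
  apply/allP=> z zs; rewrite (negbTE (h z zs)) eq_sym; apply/eqP/negbTE.
  by apply: contraTneq zs => ->; case/and4P: pt.
(* The cycle consists of [y], [x] and the entries 0 to [j] of [s], hence its length [j.+3]. *)
pose j := find (adj y) s; have js : j < size s by rewrite -has_find.
pose g i := nth y [:: y, x & s] i.
have us : uniq [:: y, x & s].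
  by have := induced_path_uniq pt; rewrite /= inE negb_or yx ys.
have g0 k : 0 < k < j.+3 -> adj (g 0) (g k) = (k == 1) || (k == j.+2).
  case: k => // -[|k] /=; first by rewrite /g /= adj_sym xy.
  rewrite !ltnS leq_eqVlt => /orP[/eqP ->|kj]; rewrite /g /=.
    by rewrite nth_find // eqxx.
  by rewrite before_find // !eqSS (ltn_eqF kj).
have gS i k : 0 < i < k -> k < j.+3 -> adj (g i) (g k) = (k == i.+1).
  case: i k => // i [|k] //= ik; rewrite ltnS => kj.
  rewrite /g /= (@induced_path_nth y (x :: s)) ?eqSS //; apply/andP; split; first exact: ik.
  exact: (leq_trans kj).
have gE (i k : nat) : i < k -> k < j.+3 ->
    adj (g i) (g k) = (k == i.+1) || (i == 0) && (k == j.+2).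
  by case: i => [|i] ik kj; [rewrite g0 ?ik|rewrite gS ?orbF].
exists j, (fun i : 'I_j.+3 => g i).
  move=> i k /eqP; rewrite nth_uniq //=; last 2 first.
  - by rewrite (leq_trans (ltn_ord i)) // !ltnS.
  - by rewrite (leq_trans (ltn_ord k)) // !ltnS.
  by move=> /eqP/val_inj.
have cycE (i k : 'I_j.+3) : i < k ->
    (k == ordS i) || (i == ordS k) = (k == i.+1 :> nat) || (i == 0 :> nat) && (k == j.+2 :> nat).
  move=> ik; rewrite -2!val_eqE /= modn_small; last by apply: leq_ltn_trans (ltn_ord k).
  congr (_ || _); have := ltn_ord k; rewrite ltnS leq_eqVlt => /orP[/eqP ->|kj].
    by rewrite modnn eqxx andbT.
  rewrite modn_small // (ltn_eqF kj) andbF; apply: ltn_eqF.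
  exact: leq_trans ik (leqnSn _).
move=> i k; have [ik|ki|/val_inj <-] := ltngtP i k.
- by rewrite cycE // gE.
- by rewrite orbC cycE // adj_sym gE.
rewrite adj_irr orbb; apply/esym/negbTE; rewrite -val_eqE /= eq_sym.
have := ltn_ord i; rewrite ltnS leq_eqVlt => /orP[/eqP ->|ij].
  by rewrite modnn.
by rewrite modn_small // (gtn_eqF (ltnSn _)).
Qed.

End Forest.

Require Import Defs.
From mathcomp Require Import all_boot all_order all_algebra.
From mathcomp Require Import all_classical reals topology normedtype homotopy.
From mathcomp Require Import realfun.

Import Order.TTheory GRing.Theory Num.Theory.
Import numFieldNormedType.Exports.
Local Open Scope classical_set_scope.
Local Open Scope ring_scope.

(** * Homotopy equivalences *)

Section Continuity.
Variable T : topologicalType.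

Lemma ptws_continuous_at (V : Type) (U : topologicalType) (F : T -> {ptws V -> U}) t :
  (forall v, {for t, continuous (fun s => F s v)}) -> {for t, continuous F}.
Proof.
move=> cF; apply/cvg_sup => v B [_ [[W oW <-] /= Wt WB]].
apply: filterS WB _; apply: (cF v); exact: open_nbhs_nbhs.
Qed.

Lemma set_type_continuous_at (X : topologicalType) (A : set X) (F : T -> set_type A) t :
  {for t, continuous (fun s => val (F s))} -> {for t, continuous F}.
Proof.
move=> cF B [_ [[W oW <-] /= Wt WB]].
apply: filterS WB _; apply: cF; exact: open_nbhs_nbhs.
Qed.

Lemma rowv_continuous_at (U : topologicalType) n (F : T -> 'rV[U]_n) t :
  (forall i, {for t, continuous (fun s => F s 0 i)}) -> {for t, continuous F}.
Proof.
move=> cF B [P Pnbhs PB]; apply: filterS (_ : (\forall s \near t, forall i, P 0 i (F s 0 i))).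
  by move=> s Ps; apply: PB => i j; rewrite ord1.
by apply: filter_forall => i; apply: (cF i).
Qed.

Lemma pair_continuous_at (X Y : topologicalType) (f : T -> X) (g : T -> Y) t :
  {for t, continuous f} -> {for t, continuous g} ->
  {for t, continuous (fun s => (f s, g s))}.
Proof. by move=> cf cg; apply: cvg_pair. Qed.

(** Pasting along a finite closed cover. Continuity of [g i] is required only at points of [A i],
    which suits maps such as [to_sphere], controlled on one lobe only. *)
Lemma closed_cover_continuous (U : topologicalType) (I : finType) (A : I -> set T)
    (f : T -> U) (g : I -> T -> U) :
  (forall i, closed (A i)) -> (forall t, exists i, A i t) ->
  (forall i t, A i t -> f t = g i t) ->
  (forall i t, A i t -> {for t, continuous (g i)}) -> continuous f.
Proof.
move=> cA covA fg cg t B Bft.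
have H : \forall s \near t, forall i, A i s -> B (f s).
  apply: filter_forall => i; have [At|nAt] := pselect (A i t).
    rewrite (fg _ _ At) in Bft.
    have h : nbhs t (g i @^-1` B) := cg i t At B Bft.
    by apply: filterS h => s Bs As; rewrite (fg _ _ As).
  have h := open_nbhs_nbhs (conj (closed_openC (cA i)) nAt).
  by apply: filterS h => s nAs As.
by apply: filterS H => s Hs; have [i As] := covA s; exact: Hs i As.
Qed.

End Continuity.

Section RealFunctions.
Variables (R : realType) (T : topologicalType) (t : T).
Implicit Types f g : T -> R.

Lemma cst_continuous_at (c : R) : {for t, continuous (fun _ : T => c)}.
Proof. exact: cvg_cst. Qed.

Lemma add_continuous_at f g : {for t, continuous f} -> {for t, continuous g} ->
  {for t, continuous (fun s => f s + g s)}.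
Proof. by move=> cf cg; exact: cvgD. Qed.

Lemma sub_continuous_at f g : {for t, continuous f} -> {for t, continuous g} ->
  {for t, continuous (fun s => f s - g s)}.
Proof. by move=> cf cg; exact: cvgB. Qed.

Lemma mul_continuous_at f g : {for t, continuous f} -> {for t, continuous g} ->
  {for t, continuous (fun s => f s * g s)}.
Proof. by move=> cf cg; exact: cvgM. Qed.

Lemma div_continuous_at f g : {for t, continuous f} -> {for t, continuous g} ->
  g t != 0 -> {for t, continuous (fun s => f s / g s)}.
Proof. by move=> cf cg g0; apply: mul_continuous_at => //; exact: cvgV. Qed.

Lemma sum_continuous_at (I : finType) (P : pred I) (F : I -> T -> R) :
  (forall i, {for t, continuous (F i)}) ->
  {for t, continuous (fun s => \sum_(i | P i) F i s)}.
Proof.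
by move=> cF; apply: cvg_big => [|i _]; [exact: add_continuous|exact: cF].
Qed.

Lemma bigmin_continuous_at (I : finType) (P : pred I) (F : I -> T -> R) c :
  (forall i, {for t, continuous (F i)}) ->
  {for t, continuous (fun s => \big[Num.min/c]_(i | P i) F i s)}.
Proof.
move=> cF; apply: cvg_big => [z|i _]; last exact: cF.
have c1 : {for z, continuous (@fst R R)} by exact: cvg_fst.
have c2 : {for z, continuous (@snd R R)} by exact: cvg_snd.
exact: (continuous_min c1 c2).
Qed.

End RealFunctions.

Section Homotopy.
Variable R : realType.

Definition clamp (t : R) : R := Num.max 0 (Num.min 1 t).

Lemma clamp_itv t : 0 <= clamp t <= 1.
Proof. by rewrite /clamp le_max lexx /= ge_max ler01 ge_min lexx. Qed.

Lemma clamp0 : clamp 0 = 0.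
Proof. by rewrite /clamp (min_idPr ler01) maxxx. Qed.

Lemma clamp1 : clamp 1 = 1.
Proof. by rewrite /clamp minxx (max_idPr ler01). Qed.

Lemma clamp_continuous : continuous clamp.
Proof.
move=> t; have cid : {for t, continuous (@id R)} by exact: cvg_id.
have c1 : {for t, continuous (fun _ : R => 1 : R)} by exact: cvg_cst.
have c0 : {for t, continuous (fun _ : R => 0 : R)} by exact: cvg_cst.
exact: (@continuous_max R R _ _ t c0 (@continuous_min R R _ _ t c1 cid)).
Qed.

(** Clamping the time extends a homotopy to the whole real line, so that no later argument involves
    continuity within a subset. *)
Lemma homotopicP (X Y : topologicalType) (f g : X -> Y) : homotopic R f g <->
  exists h : R * X -> Y, [/\ continuous h, forall x, h (0, x) = f x
                            & forall x, h (1, x) = g x].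
Proof.
split=> [[h [ch h0 h1]]|[h [ch h0 h1]]]; last first.
  by exists h; split=> //; exact: continuous_subspaceT.
exists (fun z => h (clamp z.1, z.2)); split=> [|x|x] /=; last 2 first.
- by rewrite clamp0.
- by rewrite clamp1.
have cA (z : R * X) : (`[0, 1]%classic `*` [set: X]) (clamp z.1, z.2).
  by split=> //=; rewrite in_itv /= clamp_itv.
pose c (z : R * X) : set_type (`[0, 1]%classic `*` [set: X]) :=
  exist _ (clamp z.1, z.2) (mem_set (cA z)).
have -> : (fun z => h (clamp z.1, z.2)) =
    sigL (`[0, 1]%classic `*` [set: X]) h \o c by [].
move=> z; apply: continuous_comp; last first.
  by move/subspace_sigL_continuousP : ch; exact.
apply: set_type_continuous_at.
have c1 : {for z, continuous (fun z : R * X => clamp z.1)}.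
  by apply: (@continuous_comp _ _ _ fst clamp); [exact: cvg_fst|exact: clamp_continuous].
have c2 : {for z, continuous (@snd R X)} by exact: cvg_snd.
exact: (pair_continuous_at c1 c2).
Qed.

Lemma homotopic_refl (X Y : topologicalType) (f : X -> Y) :
  continuous f -> homotopic R f f.
Proof.
move=> cf; apply/homotopicP; exists (fun z => f z.2); split=> // z.
by apply: continuous_comp; [exact: cvg_snd|exact: cf].
Qed.

Lemma homotopic_trans (X Y : topologicalType) (f g k : X -> Y) :
  homotopic R f g -> homotopic R g k -> homotopic R f k.
Proof.
move=> /homotopicP[h1 [c1 h10 h11]] /homotopicP[h2 [c2 h20 h21]].
apply/homotopicP.
exists (fun z => if z.1 <= 2^-1 then h1 (2 * z.1, z.2) else h2 (2 * z.1 - 1, z.2)).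
have half1 : 2 * 2^-1 = 1 :> R by rewrite mulfV // pnatr_eq0.
split=> [|x|x] /=; last 2 first.
- by rewrite invr_ge0 ler0n mulr0 h10.
- rewrite ifF; last by apply/negbTE; rewrite -ltNge invf_lt1 // ltr1n.
  by rewrite (_ : 2 * 1 - 1 = 1) // mulr1 addrK.
pose A (b : bool) : set (R * X) := if b then [set z | z.1 <= 2^-1] else [set z | 2^-1 <= z.1].
pose g' (b : bool) (z : R * X) : Y :=
  if b then h1 (2 * z.1, z.2) else h2 (2 * z.1 - 1, z.2).
have cfst : continuous (@fst R X) by move=> z; exact: cvg_fst.
apply: (@closed_cover_continuous _ _ _ A _ g').
- case; rewrite /A.
    by apply: (@closed_comp _ _ fst [set t : R | t <= 2^-1]) => // z _; exact: cfst.
  by apply: (@closed_comp _ _ fst [set t : R | 2^-1 <= t]) => // z _; exact: cfst.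
- move=> z; have [h|h] := leP z.1 2^-1; first by exists true.
  by exists false; exact: ltW.
- case=> z /=; first by move=> ->.
  move=> h; case: ifP => // h'.
  have -> : z.1 = 2^-1 by apply/le_anti; rewrite h h'.
  by rewrite half1 subrr h11 h20.
case=> z _.
  have c : {for z, continuous (fun z : R * X => (2 * z.1, z.2))}.
    by apply: pair_continuous_at; [apply: cvgMl_tmp; exact: cvg_fst|exact: cvg_snd].
  exact: (continuous_comp c (c1 _)).
have c : {for z, continuous (fun z : R * X => (2 * z.1 - 1, z.2))}.
  apply: pair_continuous_at; last exact: cvg_snd.
  by apply: cvgB; [apply: cvgMl_tmp; exact: cvg_fst|exact: cvg_cst].
exact: (continuous_comp c (c2 _)).
Qed.

Lemma homotopic_comp (X Y Z W : topologicalType) (f : X -> Y) (g k : Y -> Z) (l : Z -> W) :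
  continuous f -> continuous l -> homotopic R g k ->
  homotopic R (l \o g \o f) (l \o k \o f).
Proof.
move=> cf cl /homotopicP[h [ch h0 h1]]; apply/homotopicP.
exists (fun z => l (h (z.1, f z.2))); split=> [z|x|x] /=; rewrite ?h0 ?h1 //.
apply: continuous_comp; last exact: cl.
apply: (@continuous_comp _ _ _ (fun z : R * X => (z.1, f z.2)) h); last exact: ch.
apply: pair_continuous_at; first exact: cvg_fst.
by apply: continuous_comp; [exact: cvg_snd|exact: cf].
Qed.

Lemma homotopy_equivalent_sym (X Y : topologicalType) :
  homotopy_equivalent R X Y -> homotopy_equivalent R Y X.
Proof. by move=> [f [g [cf cg gf fg]]]; exists g, f. Qed.

Lemma homotopy_equivalent_trans (X Y Z : topologicalType) :
  homotopy_equivalent R X Y -> homotopy_equivalent R Y Z -> homotopy_equivalent R X Z.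
Proof.
move=> [f [g [cf cg gf fg]]] [f' [g' [cf' cg' gf' fg']]]; exists (f' \o f), (g \o g').
split.
- by move=> x; apply: continuous_comp; [exact: cf|exact: cf'].
- by move=> x; apply: continuous_comp; [exact: cg'|exact: cg].
- exact: homotopic_trans (homotopic_comp cf cg gf') gf.
exact: homotopic_trans (homotopic_comp cg' cf' fg) fg'.
Qed.

Lemma homeomorphic_homotopy_equivalent (X Y : topologicalType) (f : X -> Y) (g : Y -> X) :
  continuous f -> continuous g -> cancel f g -> cancel g f ->
  homotopy_equivalent R X Y.
Proof.
move=> cf cg fK gK; exists f, g; split=> //.
  have -> : g \o f = idfun by apply/funext => x /=; rewrite fK.
  by apply: homotopic_refl => x; exact: cvg_id.
have -> : f \o g = idfun by apply/funext => x /=; rewrite gK.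
by apply: homotopic_refl => x; exact: cvg_id.
Qed.

End Homotopy.

(** * Realizations *)

Section Realization.
Variables (R : realType) (V : finType) (K : {set {set V}}).
Implicit Types (x : realization R K) (v : V).

Lemma realizationP x : realization_set K (val x).
Proof. by apply/set_mem; exact: valP. Qed.

Lemma realization_ge0 x v : 0 <= val x v.
Proof. by have [] := realizationP x. Qed.

Lemma realization_sum x : \sum_v val x v = 1.
Proof. by have [] := realizationP x. Qed.

Lemma realization_supp x : [set v | val x v != 0]%SET \in K.
Proof. by have [] := realizationP x. Qed.

Lemma realization_le1 x v : val x v <= 1.
Proof.
rewrite -(realization_sum x) (bigD1 v) //= lerDl sumr_ge0 // => i _.
exact: realization_ge0.
Qed.

Lemma realization_eq x y : (forall v, val x v = val y v) -> x = y.
Proof. by move=> xy; apply/val_inj/funext. Qed.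

Lemma realization_coord_continuous v : continuous (fun x => val x v).
Proof.
move=> x; apply: (@continuous_comp _ _ _ (fun x : realization R K => val x) (@proj V (fun=> R) v)).
  exact: initial_continuous.
exact: proj_continuous.
Qed.

Lemma realization_continuous_at (T : topologicalType) (F : T -> realization R K) t :
  (forall v, {for t, continuous (fun s => val (F s) v)}) -> {for t, continuous F}.
Proof. by move=> cF; apply: set_type_continuous_at; exact: (ptws_continuous_at cF). Qed.

End Realization.

Section Collapse.
Variables (R : realType) (V : finType) (K : {set {set V}}) (s : {set V}) (u : V).
Hypotheses (cK : complex K) (s0 : s != finset.set0) (us : u \notin s)
  (usK : (u |: s)%SET \in K)
  (free : forall t, t \in K -> s \subset t -> t = s \/ t = (u |: s)%SET).

Let K' := (K :\ s :\ (u |: s))%SET.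
(** On [|K|] this vanishes exactly at the points of [|K'|], which the push therefore fixes. The
    default 1 does no harm, as coordinates are at most 1 and [s] is nonempty. *)
Let m (x : V -> R) : R := \big[Num.min/1]_(v in s) x v.

(* Pushes the simplex [u |: s] off its free face [s], along the straight line
   from the barycenter of [s] to [u]. *)
Let r (t : R) (x : V -> R) (v : V) : R :=
  x v - t * m x * (v \in s)%:R + t * m x * #|s|%:R * (v == u)%:R.

Let m_le x v : v \in s -> m x <= x v.
Proof. by move=> vs; exact: bigmin_le_cond. Qed.

Let m_ge0 (x : V -> R) : (forall v, 0 <= x v) -> 0 <= m x.
Proof. by move=> x0; apply: le_bigmin => // i _; exact: x0. Qed.

Let m_attained (x : realization R K) : exists2 v, v \in s & m (val x) = val x v.
Proof.
have /set0Pn[v0 v0s] := s0.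
have [|v vs h] := @eq_bigmin _ _ _ (1 : R) v0 (mem s) (fun v => val x v) v0s.
  by move=> i _; exact: realization_le1.
by exists v.
Qed.

Let r_ge0 t x : 0 <= t <= 1 -> (forall v, 0 <= x v) -> forall v, 0 <= r t x v.
Proof.
move=> /andP[t0 t1] x0 v; rewrite /r; have m0 := m_ge0 x0.
have tm : 0 <= t * m x by exact: mulr_ge0.
have tm' : t * m x <= m x by rewrite ler_piMl.
have [vs|vs] := boolP (v \in s).
  have -> : v == u = false by apply/negbTE; apply: contraNneq us => <-.
  by rewrite mulr1 mulr0 addr0 subr_ge0 (le_trans tm') // m_le.
by rewrite mulr0 subr0 addr_ge0 // mulr_ge0 ?ler0n // mulr_ge0 ?ler0n.
Qed.

Let r_sum t x : \sum_v r t x v = \sum_v x v.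
Proof.
rewrite /r !big_split /= sumrN -addrA -[RHS]addr0; congr (_ + _).
rewrite -!mulr_sumr -mulrA.
have -> : \sum_v (v \in s)%:R = #|s|%:R :> R.
  by rewrite -sum1_card natr_sum [RHS]big_mkcond /=; apply: eq_bigr => v _; case: (_ \in _).
have -> : \sum_v (v == u)%:R = 1 :> R.
  by rewrite (bigD1 u) //= eqxx big1 ?addr0 // => v /negbTE ->.
by rewrite mulr1 addrC mulrA subrr.
Qed.

Let r_id t x : m x = 0 -> r t x =1 x.
Proof. by move=> mx v; rewrite /r mx mulr0 !mul0r subr0 addr0. Qed.

Let r_supp t (x : realization R K) : [set v | r t (val x) v != 0]%SET \in K.
Proof.
have [mx|mx] := eqVneq (m (val x)) 0.
  have -> : [set v | r t (val x) v != 0]%SET = [set v | val x v != 0]%SET.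
    by apply/setP=> v; rewrite !inE r_id.
  exact: realization_supp.
apply: cK usK; apply/fintype.subsetP=> v; rewrite !inE /r.
have : s \subset [set v | val x v != 0]%SET.
  apply/fintype.subsetP=> w ws; rewrite inE; apply: contraNneq mx => xw.
  apply/eqP/le_anti; rewrite -{1}xw m_le //= m_ge0 // => i; exact: realization_ge0.
have [//|vu] := eqVneq v u; case: (boolP (v \in s)) => //= vs.
move=> /(free (realization_supp x)) h.
rewrite !mulr0 subr0 addr0 => xv; have : v \in [set v | val x v != 0]%SET by rewrite inE.
by case: h => ->; rewrite ?inE (negbTE vs) ?(negbTE vu).
Qed.

Let r1_supp (x : realization R K) : [set v | r 1 (val x) v != 0]%SET \in K'.
Proof.
have [v0 v0s mx] := m_attained x.
have v0r : v0 \notin [set v | r 1 (val x) v != 0]%SET.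
  rewrite inE negbK /r v0s mx mulr1 mul1r subrr.
  have -> : v0 == u = false by apply/negbTE; apply: contraNneq us => <-.
  by rewrite mulr0 addr0.
rewrite !inE r_supp andbT; apply/andP; split; apply: contraNneq v0r => ->.
  by rewrite setU1r.
by [].
Qed.

Let m0 (x : realization R K') : m (val x) = 0.
Proof.
have := realization_supp x; set S := [set v | _]%SET; rewrite !inE => /and3P[h1 h2 SK].
have [/(free SK)[|] /eqP|] := boolP (s \subset S); rewrite ?(negbTE h1) ?(negbTE h2) //.
move=> /fintype.subsetPn[v vs]; rewrite inE negbK => /eqP xv.
apply/le_anti; rewrite -{1}xv m_le //= m_ge0 // => i; exact: realization_ge0.
Qed.

Let F (t : R) (t01 : 0 <= t <= 1) (x : realization R K) : realization R K :=
  exist _ (r t (val x) : {ptws V -> R}) (mem_set (And3 (r_ge0 t01 (@realization_ge0 _ _ _ x))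
     (etrans (r_sum t (val x)) (realization_sum x)) (r_supp t x))).

Let one01 : 0 <= (1 : R) <= 1. Proof. by rewrite ler01 lexx. Qed.

Let f (x : realization R K) : realization R K' :=
  exist _ (r 1 (val x) : {ptws V -> R}) (mem_set (And3 (r_ge0 one01 (@realization_ge0 _ _ _ x))
     (etrans (r_sum 1 (val x)) (realization_sum x)) (r1_supp x))).

Let g_supp (x : realization R K') : [set v | val x v != 0]%SET \in K.
Proof. by have := realization_supp x; rewrite !inE => /and3P[]. Qed.

Let g (x : realization R K') : realization R K :=
  exist _ (val x) (mem_set (And3 (@realization_ge0 _ _ _ x) (realization_sum x) (g_supp x))).

Let r_continuous (T : topologicalType) (a : T -> R) (X : T -> realization R K) z v :
  {for z, continuous a} -> {for z, continuous X} ->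
  {for z, continuous (fun w => r (a w) (val (X w)) v)}.
Proof.
move=> ca cX.
have cx w : {for z, continuous (fun z => val (X z) w)}.
  exact: (continuous_comp cX (@realization_coord_continuous _ _ _ w _)).
have cm : {for z, continuous (fun z => m (val (X z)))} by exact: bigmin_continuous_at.
have cam := mul_continuous_at ca cm; rewrite /r.
apply: add_continuous_at; first apply: sub_continuous_at => //.
  by apply: mul_continuous_at => //; exact: cst_continuous_at.
by do 2 (apply: mul_continuous_at; last exact: cst_continuous_at).
Qed.

Lemma collapse_homotopy_equivalent :
  homotopy_equivalent R (realization R K) (realization R K').
Proof.
exists f, g; split.
- move=> x; apply: realization_continuous_at => v /=.
  by apply: (@r_continuous _ (fun=> 1) id); [exact: cst_continuous_at|exact: cvg_id].
- by move=> x; apply: realization_continuous_at => v; exact: realization_coord_continuous.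
(* The homotopy has to start at [g \o f], which is the push at time 1, and end at the identity;
   hence the reversed time. *)
- have c01 (t : R) : 0 <= 1 - clamp t <= 1.
    by have /andP[h1 h2] := clamp_itv t; rewrite subr_ge0 h2 gerBl.
  apply/homotopicP; exists (fun z => F (c01 z.1) z.2); split=> [z|x|x].
  + apply: realization_continuous_at => v /=; apply: (@r_continuous _ (fun z => 1 - clamp z.1) snd).
      apply: sub_continuous_at; first exact: cst_continuous_at.
      by apply: (@continuous_comp _ _ _ fst (@clamp R)); [exact: cvg_fst|exact: clamp_continuous].
    exact: cvg_snd.
  + by apply: realization_eq => v /=; rewrite clamp0 subr0.
  + by apply: realization_eq => v /=; rewrite clamp1 subrr /r !mul0r subr0 addr0.
have -> : f \o g = idfun.
  by apply/funext => x; apply: realization_eq => v /=; rewrite r_id // m0.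
by apply: homotopic_refl => x; exact: cvg_id.
Qed.

End Collapse.

Section Rename.
Variables (R : realType) (V W : finType) (f : V -> W) (K : {set {set V}}).
Hypothesis f_inj : injective f.
Let L := [set (f @: s)%SET | s : {set V} in K]%SET.

Let push (x : V -> R) (w : W) : R := \sum_(v | f v == w) x v.

Let push_f x v : push x (f v) = x v.
Proof.
rewrite /push (bigD1 v) //= big1 ?addr0 // => v' /andP[/eqP/f_inj ->].
by rewrite eqxx.
Qed.

Let push0 x w : (forall v, f v != w) -> push x w = 0.
Proof. by move=> h; rewrite /push big1 // => v /eqP fv; have := h v; rewrite fv eqxx. Qed.

Let push_ge0 x : (forall v, 0 <= x v) -> forall w, 0 <= push x w.
Proof. by move=> x0 w; apply: sumr_ge0 => v _; exact: x0. Qed.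

Let push_sum x : \sum_w push x w = \sum_v x v.
Proof. by rewrite [RHS](partition_big f predT). Qed.

Let imgP w : (exists v, w = f v) \/ (forall v, f v != w).
Proof.
case: (pickP (fun v => f v == w)) => [v /eqP <-|h]; first by left; exists v.
by right=> v; rewrite h.
Qed.

Let push_supp (x : realization R K) : [set w | push (val x) w != 0]%SET \in L.
Proof.
apply/imsetP; exists [set v | val x v != 0]%SET; first exact: realization_supp.
apply/setP=> w; rewrite inE; apply/idP/imsetP => [|[v]]; last first.
  by rewrite inE => xv ->; rewrite push_f.
have [[v ->]|h] := imgP w; last by rewrite push0 ?eqxx.
by rewrite push_f => xv; exists v; rewrite ?inE.
Qed.

Let pull_supp (y : realization R L) : [set v | val y (f v) != 0]%SET \in K.
Proof.
have /imsetP[s sK sE] := realization_supp y; suff -> : [set v | val y (f v) != 0]%SET = s by [].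
by apply/setP=> v; have := congr1 (fun t : {set W} => f v \in t) sE; rewrite !inE mem_imset.
Qed.

Let y0 (y : realization R L) w : (forall v, f v != w) -> val y w = 0.
Proof.
move=> h; have /imsetP[s sK sE] := realization_supp y.
have := congr1 (fun t : {set W} => w \in t) sE; rewrite inE => h'.
apply/eqP; apply/negPn; rewrite h'; apply/negP=> /imsetP[v _ wv].
by have := h v; rewrite wv eqxx.
Qed.

Let push_pull (y : realization R L) w : push (fun v => val y (f v)) w = val y w.
Proof. by have [[v ->]|h] := imgP w; rewrite ?push_f // push0 // y0. Qed.

Let pull_sum (y : realization R L) : \sum_v val y (f v) = 1.
Proof.
rewrite -(realization_sum y) -(push_sum (fun v => val y (f v))).
by apply: eq_bigr => w _; exact: push_pull.
Qed.

Let F (x : realization R K) : realization R L :=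
  exist _ (push (val x) : {ptws W -> R}) (mem_set (And3 (push_ge0 (@realization_ge0 _ _ _ x))
     (etrans (push_sum (val x)) (realization_sum x)) (push_supp x))).

Let G (y : realization R L) : realization R K :=
  exist _ ((fun v => val y (f v)) : {ptws V -> R})
    (mem_set (And3 (fun v => realization_ge0 y (f v)) (pull_sum y) (pull_supp y))).

Lemma rename_homotopy_equivalent :
  homotopy_equivalent R (realization R K) (realization R L).
Proof.
apply: (@homeomorphic_homotopy_equivalent _ _ _ F G).
- move=> x; apply: realization_continuous_at => w /=; rewrite /push.
  by apply: sum_continuous_at => v; exact: realization_coord_continuous.
- by move=> y; apply: realization_continuous_at => v; exact: realization_coord_continuous.
- by move=> x; apply: realization_eq => v /=; rewrite push_f.
- by move=> y; apply: realization_eq => w /=; exact: push_pull.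
Qed.

End Rename.

Lemma simple_equiv_homotopy_equivalent (R : realType) (V W : finType) (K : {set {set V}}) p
    (L : {set {set W}}) q :
  simple_equiv K p L q -> homotopy_equivalent R (realization R K) (realization R L).
Proof.
elim=> {V W K p L q}
  [V K p s u cK pK s0 sp us usK free|V W f K p f_inj|V W K p L q _|
   V1 V2 V3 K1 p1 K2 p2 K3 p3 _ h1 _ h2].
- exact: collapse_homotopy_equivalent.
- exact: rename_homotopy_equivalent.
- exact: homotopy_equivalent_sym.
exact: homotopy_equivalent_trans h1 h2.
Qed.

(** * Homotopy invariance of polyhedral joins *)

Section Weights.
Variables (R : realType) (G : finType) (adj : rel G) (A : finType) (K : {set {set A}}).
Variable k0 : realization R K.
Local Notation X := (realization R (indep_join adj K [set: G]%SET)).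

Definition weight (w : G) (x : X) : R := \sum_a val x (w, a).

Lemma weight_ge0 w x : 0 <= weight w x.
Proof. by apply: sumr_ge0 => a _; exact: realization_ge0. Qed.

Lemma weight_eq0 w x a : weight w x = 0 -> val x (w, a) = 0.
Proof.
move/eqP; rewrite psumr_eq0 => [|b _]; last exact: realization_ge0.
by move=> /allP/(_ a (mem_index_enum _))/eqP.
Qed.

Lemma weight_sum x : \sum_w weight w x = 1.
Proof.
rewrite /weight pair_bigA /= -(realization_sum x).
by apply: eq_bigr => -[w a].
Qed.

(** A fiber of weight zero determines no point of [|K|], and [k0] fills the gap; the result is later
    multiplied by the weight, so the choice leaves no trace. *)
Let nval (w : G) (x : X) (a : A) : R :=
  if weight w x == 0 then val k0 a else val x (w, a) / weight w x.

Let nvalP w x : realization_set K (nval w x).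
Proof.
rewrite /nval; have [wx|wx] := eqVneq (weight w x) 0.
  exact: realizationP k0.
split=> [a||].
- by apply: divr_ge0; [exact: realization_ge0|exact: weight_ge0].
- by rewrite -mulr_suml mulfV.
have -> : [set a | val x (w, a) / weight w x != 0]%SET =
    fiber w [set v | val x v != 0]%SET.
  by apply/setP=> a; rewrite !inE mulf_eq0 invr_eq0 (negbTE wx) orbF.
by have := realization_supp x; rewrite inE => /and3P[_ _ /forallP].
Qed.

Definition normalized w x : realization R K :=
  exist _ (nval w x : {ptws A -> R}) (mem_set (nvalP w x)).

Lemma normalizedE w x a : weight w x != 0 ->
  val (normalized w x) a = val x (w, a) / weight w x.
Proof. by move=> /negbTE wx; rewrite /= /nval wx. Qed.

Lemma weight_continuous w : continuous (weight w).
Proof. by move=> x; apply: sum_continuous_at => a; exact: realization_coord_continuous. Qed.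

Lemma near_eq_continuous_at (T U : topologicalType) (f g : T -> U) t :
  (\forall s \near t, f s = g s) -> {for t, continuous g} -> {for t, continuous f}.
Proof.
move=> fg cg B; rewrite (nbhs_singleton fg) => /cg gB.
by apply: filterS2 fg gB => s /= ->.
Qed.

Lemma normalized_continuous_at w x : weight w x != 0 ->
  {for x, continuous (normalized w)}.
Proof.
move=> wx; apply: realization_continuous_at => a.
have cg : {for x, continuous (fun y : X => val y (w, a) / weight w y)}.
  apply: div_continuous_at => //; first exact: realization_coord_continuous.
  exact: weight_continuous.
apply: near_eq_continuous_at cg.
have h : \forall y \near x, weight w y != 0.
  have : nbhs (weight w x) [set r | r != 0].
    by apply: open_nbhs_nbhs; split => //; exact: open_neq.
  exact: weight_continuous.
by apply: filterS h => y; exact: normalizedE.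
Qed.

End Weights.

Section JoinMap.
Variables (R : realType) (G : finType) (adj : rel G).
Local Notation join K := (realization R (indep_join adj K [set: G]%SET)).

Section Map.
Variables (A B : finType) (K : {set {set A}}) (L : {set {set B}}).
Hypothesis L0 : finset.set0 \in L.
Variable k0 : realization R K.

(* Homogeneous extension of [phi] in each fiber; it preserves the weights, hence it
   is continuous also where a weight vanishes. *)
Let lval (phi : realization R K -> realization R L) (x : join K) (p : G * B) : R :=
  weight p.1 x * val (phi (normalized k0 p.1 x)) p.2.

Let lvalP phi x : realization_set (indep_join adj L [set: G]%SET) (lval phi x).
Proof.
split=> [p||].
- by apply: mulr_ge0; [exact: weight_ge0|exact: realization_ge0].
- rewrite /lval -(pair_bigA _ (fun w b => weight w x * val (phi (normalized k0 w x)) b)) /=.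
  rewrite -(weight_sum x); apply: eq_bigr => w _.
  by rewrite -mulr_sumr realization_sum mulr1.
have wtP w : weight w x != 0 -> exists2 a, val x (w, a) != 0 & true.
  move=> wx; case: (pickP (fun a => val x (w, a) != 0)) => [a ax|h]; first by exists a.
  by case/eqP: wx; apply: big1 => a _; have /negbFE/eqP := h a.
rewrite inE; apply/and3P; split.
- by apply/fintype.subsetP=> p _; rewrite !inE.
- apply/forall_inP=> p; rewrite inE mulf_eq0 negb_or => /andP[/wtP[a pa _] _].
  apply/forall_inP=> p'; rewrite inE mulf_eq0 negb_or => /andP[/wtP[a' pa' _] _].
  have := realization_supp x; rewrite inE => /and3P[_ /forall_inP h _].
  have := forall_inP (h (p.1, a) _) (p'.1, a'); rewrite !inE; exact.
apply/forallP=> w; have [wx|wx] := eqVneq (weight w x) 0.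
  rewrite (_ : fiber _ _ = finset.set0) //; apply/setP=> b.
  by rewrite !inE /lval /= wx mul0r eqxx.
rewrite (_ : fiber _ _ = [set b | val (phi (normalized k0 w x)) b != 0]%SET).
  exact: realization_supp.
by apply/setP=> b; rewrite !inE /lval /= mulf_eq0 (negbTE wx).
Qed.

Definition join_map phi x : join L :=
  exist _ (lval phi x : {ptws (G * B) -> R}) (mem_set (lvalP phi x)).

Lemma join_mapE phi x w b :
  val (join_map phi x) (w, b) = weight w x * val (phi (normalized k0 w x)) b.
Proof. by []. Qed.

Lemma weight_join_map phi x w : weight w (join_map phi x) = weight w x.
Proof.
by rewrite {1}/weight; under eq_bigr do rewrite join_mapE;
  rewrite -mulr_sumr realization_sum mulr1.
Qed.

(** The parameter in [T] lets one statement cover both extended maps and extended homotopies. Where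
    the weight vanishes, each coordinate is squeezed between 0 and the weight. *)
Lemma join_map_continuous_at (S T : topologicalType) (h : T * realization R K -> realization R L)
    (a : S -> T) (x : S -> join K) s :
  continuous h -> {for s, continuous a} -> {for s, continuous x} ->
  {for s, continuous (fun s' => join_map (fun k => h (a s', k)) (x s'))}.
Proof.
move=> ch ca cx; apply: realization_continuous_at => -[w b].
have cw : {for s, continuous (fun s' => weight w (x s'))}.
  exact: (continuous_comp cx (@weight_continuous _ _ _ _ _ w _)).
have [wx|wx] := eqVneq (weight w (x s)) 0; last first.
  have cn : {for s, continuous (fun s' => normalized k0 w (x s'))}.
    exact: (continuous_comp cx (normalized_continuous_at wx)).
  have chn : {for s, continuous (fun s' => h (a s', normalized k0 w (x s')))}.
    exact: (continuous_comp (pair_continuous_at ca cn) (ch _)).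
  apply: mul_continuous_at => //.
  exact: (continuous_comp chn (@realization_coord_continuous _ _ _ b _)).
rewrite /prop_for /continuous_at join_mapE wx mul0r.
apply: (@squeeze_cvgr _ _ _ _ (fun=> 0) (fun s' => weight w (x s'))).
- apply: nearW => s'; rewrite join_mapE mulr_ge0 ?weight_ge0 ?realization_ge0 //=.
  by rewrite ler_piMr ?weight_ge0 ?realization_le1.
- exact: cvg_cst.
by rewrite -wx; exact: cw.
Qed.

End Map.

Lemma join_map_id (A : finType) (K : {set {set A}}) (K0 : finset.set0 \in K) (k0 : realization R K) x :
  join_map K0 k0 idfun x = x.
Proof.
apply: realization_eq => -[w a]; rewrite join_mapE; have [wx|wx] := eqVneq (weight w x) 0.
  by rewrite wx mul0r weight_eq0.
by rewrite normalizedE // mulrC divfK.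
Qed.

Lemma join_map_comp (A B C : finType) (K : {set {set A}}) (L : {set {set B}}) (M : {set {set C}})
   (L0 : finset.set0 \in L) (M0 : finset.set0 \in M) (k0 : realization R K) (l0 : realization R L)
   (phi : realization R K -> realization R L) (psi : realization R L -> realization R M) x :
  join_map M0 l0 psi (join_map L0 k0 phi x) = join_map M0 k0 (psi \o phi) x.
Proof.
apply: realization_eq => -[w c]; rewrite !join_mapE weight_join_map.
have [wx|wx] := eqVneq (weight w x) 0; first by rewrite wx !mul0r.
congr (_ * val (psi _) c); apply: realization_eq => b.
by rewrite normalizedE weight_join_map // join_mapE mulrAC mulfV // mul1r.
Qed.

(** By [join_map_id] and [join_map_comp] the extension is functorial; extending a homotopy at each
    time gives the homotopy between the extensions. *)
Lemma indep_join_homotopy_equivalent (A B : finType) (K : {set {set A}}) (L : {set {set B}}) :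
  finset.set0 \in K -> finset.set0 \in L -> realization R K ->
  homotopy_equivalent R (realization R K) (realization R L) ->
  homotopy_equivalent R (join K) (join L).
Proof.
move=> K0 L0 k0 [f [g [cf cg gf fg]]]; pose l0 := f k0.
have half (A' B' : finType) (K' : {set {set A'}}) (L' : {set {set B'}})
    (K0' : finset.set0 \in K') (L0' : finset.set0 \in L') (k0' : realization R K')
    (l0' : realization R L')
    (f' : realization R K' -> realization R L') (g' : realization R L' -> realization R K') :
    continuous f' -> continuous g' -> homotopic R (g' \o f') idfun ->
    homotopic R (join_map K0' l0' g' \o join_map L0' k0' f') idfun.
  move=> cf' cg' /homotopicP[h [ch h0 h1]]; apply/homotopicP.
  exists (fun z => join_map K0' k0' (fun k => h (z.1, k)) z.2); split=> [z|x|x].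
  - by apply: join_map_continuous_at => //; [exact: cvg_fst|exact: cvg_snd].
  - rewrite /= join_map_comp; congr (join_map _ _ _ x); apply/funext => k; exact: h0.
  by rewrite /= -[RHS](join_map_id K0' k0'); congr (join_map _ _ _ x); apply/funext => k; exact: h1.
have cl (A' B' : finType) (K' : {set {set A'}}) (L' : {set {set B'}})
    (L0' : finset.set0 \in L') (k0' : realization R K')
    (f' : realization R K' -> realization R L') :
    continuous f' -> continuous (join_map L0' k0' f').
  move=> cf' x; apply: (@join_map_continuous_at _ _ _ _ _ _ _ R (fun z => f' z.2) (fun=> 0) id).
  - by move=> z; apply: continuous_comp; [exact: cvg_snd|exact: cf'].
  - exact: cst_continuous_at.
  exact: cvg_id.
exists (join_map L0 k0 f), (join_map K0 l0 g); split; [exact: cl|exact: cl|exact: half|exact: half].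
Qed.

End JoinMap.

(** * Standard complexes and wedges of spheres *)

Section StdSphere.
Variables (R : realType) (I : finType) (d : I -> nat) (i : I).
Local Notation X := (realization R (std d)).
Local Notation n := (d i).+1.
Implicit Types (x : X) (y : sphere R (d i)) (v : std_vertex d).

Let vert (j : 'I_n) : std_vertex d := Some (@Tagged _ i (fun i => 'I_(d i).+1) j).
(* The coordinate of index 0 of the ambient space of the sphere corresponds to
   the base vertex [None], and the vertex [vert 0] to no coordinate. *)
Let coord_vertex (j : 'I_n) : std_vertex d := if j == 0 then None else vert j.

Let lobe_cases v : v \in lobe d i -> v = vert 0 \/ exists j, v = coord_vertex j.
Proof.
case: v => [[k j]|]; rewrite inE /=; last by move=> _; right; exists 0; rewrite /coord_vertex eqxx.
move=> /eqP ki; subst k; have [->|j0] := eqVneq j 0; first by left.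
by right; exists j; rewrite /coord_vertex (negbTE j0).
Qed.

Let vert0_lobe : vert 0 \in lobe d i. Proof. by rewrite inE /=. Qed.

Let coord_lobe j : coord_vertex j \in lobe d i.
Proof. by rewrite /coord_vertex; case: eqP => _; rewrite inE /=. Qed.

Definition in_lobe : set X := [set x | forall v, v \notin lobe d i -> val x v = 0].

Lemma closed_in_lobe : closed in_lobe.
Proof.
have -> : in_lobe = \bigcap_(v in [set v | v \notin lobe d i]) [set x | val x v = 0].
  by apply/seteqP; split=> x h v; exact: h.
apply: closed_bigI => v _.
apply: (@closed_comp _ _ (fun x : X => val x v) [set 0 : R]); last exact: closed_eq.
by move=> x _; exact: realization_coord_continuous.
Qed.

(** The support might be a simplex on account of another lobe, but then it is contained in the
    common vertex [None], still a proper face. *)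
Lemma in_lobe_zero x : in_lobe x -> exists2 v, v \in lobe d i & val x v = 0.
Proof.
move=> xi; have := realization_supp x; set S := [set v | _]%SET => SK.
suff /properP[_ [v vi]] : S \proper lobe d i.
  by rewrite inE negbK => /eqP; exists v.
have Si : S \subset lobe d i.
  apply/fintype.subsetP=> v; rewrite inE; apply: contraNT => vi.
  by rewrite xi.
have SN : S \subset [set None]%SET -> S \proper lobe d i.
  move=> h; apply/properP; split=> //; exists (vert 0) => //.
  by apply/negP=> /(fintype.subsetP h); rewrite inE.
move: SK; rewrite inE => /orP[/SN//|/existsP[k Sk]].
have [<-//|ki] := eqVneq k i; apply: SN; apply/fintype.subsetP=> v vS.
have := fintype.subsetP Si v vS; have := fintype.subsetP (proper_sub Sk) v vS.
by case: v {vS} => [v|]; rewrite !inE //= => /eqP ->; rewrite (negbTE ki).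
Qed.

(** Subtracting the coordinate of [vert 0] identifies the space of all coordinates modulo the
    diagonal with the ambient space of the sphere. Each class has exactly one representative with
    minimum 0, so rays from the origin correspond to points of the boundary of the simplex. *)
Let e x (j : 'I_n) : R := val x (coord_vertex j) - val x (vert 0).
Let N x : R := Num.sqrt (\sum_j e x j ^+ 2).

Let e_continuous j : continuous (e^~ j).
Proof. by move=> x; apply: sub_continuous_at; exact: realization_coord_continuous. Qed.

Let N_continuous : continuous N.
Proof.
move=> x; have c : {for x, continuous (fun x => \sum_j e x j ^+ 2)}.
  by apply: sum_continuous_at => j; apply: mul_continuous_at; exact: e_continuous.
exact: (continuous_comp c (@sqrt_continuous R _)).
Qed.

Let N_eq0 x : N x = 0 -> forall j, e x j = 0.
Proof.
move=> /eqP; rewrite sqrtr_eq0 => h j.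
have h0 : \sum_j e x j ^+ 2 = 0.
  by apply/le_anti; rewrite h sumr_ge0 // => k _; exact: sqr_ge0.
move/eqP: h0; rewrite psumr_eq0 => [|k _]; last exact: sqr_ge0.
by move=> /allP/(_ j (mem_index_enum _)); rewrite sqrf_eq0 => /eqP.
Qed.

Lemma in_lobe_norm x : in_lobe x -> N x != 0.
Proof.
move=> xi; apply/eqP=> /N_eq0 e0; have [v vi xv] := in_lobe_zero xi.
have ev w : w \in lobe d i -> val x w = val x (vert 0).
  move=> /lobe_cases[->//|[j ->]]; apply/eqP; rewrite -subr_eq0; apply/eqP; exact: e0.
have := realization_sum x; rewrite big1 => [/eqP|w _]; first by rewrite eq_sym oner_eq0.
have [wi|wi] := boolP (w \in lobe d i); last exact: xi.
by rewrite ev // -(ev v vi).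
Qed.

(** The pole is a mere default value: by [in_lobe_norm] the norm does not vanish on the lobe. *)
Let to_row x : 'rV[R]_n :=
  if N x == 0 then delta_mx 0 0 else \row_j (e x j / N x).

Let to_rowP x : sphere_set (to_row x).
Proof.
rewrite /to_row; case: eqP => [_|/eqP Nx]; first exact/set_mem/sphere_pole_subproof.
rewrite /sphere_set /=; under eq_bigr do rewrite mxE expr_div_n.
rewrite -mulr_suml sqr_sqrtr ?sumr_ge0 // => [|j _]; last exact: sqr_ge0.
rewrite mulfV //; apply: contra Nx => /eqP h.
by rewrite /N h sqrtr0.
Qed.

Definition to_sphere x : sphere R (d i) := exist _ (to_row x) (mem_set (to_rowP x)).

Lemma to_sphere_continuous_at x : in_lobe x -> {for x, continuous to_sphere}.
Proof.
move=> /in_lobe_norm Nx; apply: set_type_continuous_at; apply: rowv_continuous_at => j.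
have cg : {for x, continuous (fun x' : X => e x' j / N x')}.
  by apply: div_continuous_at => //; [exact: e_continuous|exact: N_continuous].
apply: near_eq_continuous_at cg.
have h : \forall y \near x, N y != 0.
  have : nbhs (N x) [set r | r != 0].
    by apply: open_nbhs_nbhs; split => //; exact: open_neq.
  exact: N_continuous.
by apply: filterS h => x' /negbTE Nx'; rewrite /= /to_row Nx' mxE.
Qed.

(** The default 0 stands for the coordinate of [vert 0]. Subtracting this minimum makes all
    coordinates nonnegative and at least one of them zero, as in the boundary of the simplex. *)
Let m y : R := \big[Num.min/0]_j val y 0 j.

Let m_le0 y : m y <= 0. Proof. exact: bigmin_le_id. Qed.

Let m_le y j : m y <= val y 0 j. Proof. exact: bigmin_le. Qed.

Let m_attained y : m y = 0 \/ exists j, m y = val y 0 j.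
Proof.
rewrite /m; elim/big_ind: _ => [|a b|j _]; [by left| |by right; exists j].
by rewrite /Num.min; case: ifP.
Qed.

(** The inverse of [e] before normalization. The test [k == i] gives no conversion of [j] to ['I_n],
    so [inord] is used; it is the identity when [k] is [i]. *)
Let u y v : R := match v with
  | None => val y 0 0 - m y
  | Some (existT k j) => if k == i then (if j == 0 then 0 else val y 0 (inord j)) - m y
                         else 0
  end.

Let u_vert0 y : u y (vert 0) = - m y.
Proof. by rewrite /u /= eqxx sub0r. Qed.

Let u_coord y j : u y (coord_vertex j) = val y 0 j - m y.
Proof.
rewrite /coord_vertex; case: (eqVneq j 0) => [->//|j0].
by rewrite /u /= eqxx (negbTE j0) inord_val.
Qed.

Let u_out y v : v \notin lobe d i -> u y v = 0.
Proof. by case: v => [[k j]|]; rewrite inE //= => /negbTE ->. Qed.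

Let u_ge0 y v : 0 <= u y v.
Proof.
have [vi|/u_out ->//] := boolP (v \in lobe d i).
case: (lobe_cases vi) => [->|[j ->]]; first by rewrite u_vert0 oppr_ge0.
by rewrite u_coord subr_ge0.
Qed.

Let T y : R := \sum_v u y v.

Let T_gt0 y : 0 < T y.
Proof.
rewrite lt_def sumr_ge0 ?andbT => [|v _]; last exact: u_ge0.
apply/eqP => /eqP; rewrite psumr_eq0 => [|v _]; last exact: u_ge0.
move=> /allP u0; have u0' v : u y v = 0 by apply/eqP; exact: u0 (mem_index_enum _).
have m0 : m y = 0 by apply/eqP; rewrite -oppr_eq0 -u_vert0 u0'.
have /set_mem := valP y; rewrite /sphere_set /= big1 => [/eqP|j _].
  by rewrite eq_sym oner_eq0.
by rewrite -[val y 0 j]subr0 -m0 -u_coord u0' expr0n.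
Qed.

Let T_neq0 y : T y != 0. Proof. by rewrite gt_eqF. Qed.

Let uvalP y : realization_set (std d) (fun v => u y v / T y).
Proof.
split=> [v||].
- by rewrite divr_ge0 // ltW.
- by rewrite -mulr_suml -/(T y) mulfV.
rewrite inE; apply/orP; right; apply/existsP; exists i.
have E v : (v \in [set v | u y v / T y != 0]%SET) = (u y v != 0).
  by rewrite inE mulf_eq0 invr_eq0 (negbTE (T_neq0 y)) orbF.
apply/properP; split.
  by apply/fintype.subsetP=> v; rewrite E; apply: contraNT => /u_out ->.
case: (m_attained y) => [m0|[j mj]].
  by exists (vert 0) => //; rewrite E u_vert0 m0 oppr0 eqxx.
by exists (coord_vertex j) => //; rewrite E u_coord mj subrr eqxx.
Qed.

Definition of_sphere y : X :=
  exist _ ((fun v => u y v / T y) : {ptws std_vertex d -> R}) (mem_set (uvalP y)).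

Let of_sphereE y v : val (of_sphere y) v = u y v / T y. Proof. by []. Qed.

Lemma of_sphere_continuous : continuous of_sphere.
Proof.
move=> y; apply: realization_continuous_at => v.
have cy j : {for y, continuous (fun y : sphere R (d i) => val y 0 j)}.
  have c1 : {for y, continuous (fun y : sphere R (d i) => val y)} by exact: initial_continuous.
  exact: (continuous_comp c1 (@coord_continuous _ _ _ 0 j _)).
have cm : {for y, continuous m} by exact: bigmin_continuous_at.
have cu w : {for y, continuous (u^~ w)}.
  case: w => [[k j]|]; last exact: sub_continuous_at.
  rewrite /u; case: (k == i); last exact: cst_continuous_at.
  apply: sub_continuous_at => //; case: (j == 0) => //; exact: cst_continuous_at.
by apply: div_continuous_at => //; exact: sum_continuous_at.
Qed.

Lemma of_sphere_in_lobe y : in_lobe (of_sphere y).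
Proof. by move=> v vi; rewrite of_sphereE u_out // mul0r. Qed.

Lemma of_sphere_pole v : val (of_sphere (sphere_pole R (d i))) v = (v == None)%:R.
Proof.
have yj j : val (sphere_pole R (d i)) 0 j = (j == 0)%:R by rewrite /sphere_pole /= mxE.
have m0 : m (sphere_pole R (d i)) = 0.
  apply/le_anti; rewrite m_le0 /=; apply: le_bigmin => // j _.
  by rewrite yj ler0n.
have uE w : u (sphere_pole R (d i)) w = (w == None)%:R.
  case: w => [[k j]|]; rewrite /u m0 subr0 ?yj ?eqxx //.
  case: (eqVneq k i) => // ki; subst k; case: (eqVneq j 0) => // j0.
  by rewrite inord_val (negbTE j0).
have TE : T (sphere_pole R (d i)) = 1.
  rewrite /T (eq_bigr _ (fun w _ => uE w)) (bigD1 None) //= big1 ?addr0 //.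
  by move=> w /negbTE ->.
by rewrite of_sphereE uE TE divr1.
Qed.

Lemma to_sphereK x : in_lobe x -> of_sphere (to_sphere x) = x.
Proof.
move=> xi; have Nx := in_lobe_norm xi.
have N0 : 0 < N x by rewrite lt_def Nx sqrtr_ge0.
have yj j : val (to_sphere x) 0 j = e x j / N x by rewrite /= /to_row (negbTE Nx) mxE.
have mE : m (to_sphere x) = - val x (vert 0) / N x.
  apply/le_anti/andP; split.
    have [v vi xv] := in_lobe_zero xi; case: (lobe_cases vi) => [vE|[j vE]].
      by rewrite -vE xv oppr0 mul0r.
    by apply: le_trans (m_le _ j) _; rewrite yj /e -vE xv sub0r.
  apply: le_bigmin => [|j _].
    by rewrite mulNr oppr_le0 divr_ge0 ?realization_ge0 // ltW.
  by rewrite yj ler_pM2r ?invr_gt0 // /e lerDr realization_ge0.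
have uE v : u (to_sphere x) v = val x v / N x.
  have [vi|vi] := boolP (v \in lobe d i); last by rewrite u_out // xi // mul0r.
  case: (lobe_cases vi) => [->|[j ->]]; first by rewrite u_vert0 mE mulNr opprK.
  by rewrite u_coord yj mE -mulrBl opprK /e subrK.
apply: realization_eq => v; rewrite of_sphereE uE (_ : T _ = (N x)^-1) ?invrK ?divfK //.
by rewrite /T; under eq_bigr do rewrite uE; rewrite -mulr_suml realization_sum mul1r.
Qed.

Lemma of_sphereK y : to_sphere (of_sphere y) = y.
Proof.
have ej j : e (of_sphere y) j = val y 0 j / T y.
  by rewrite /e !of_sphereE u_coord u_vert0 -mulrBl opprK subrK.
have NE : N (of_sphere y) = (T y)^-1.
  rewrite /N; under eq_bigr do rewrite ej expr_div_n; rewrite -mulr_suml.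
  have /set_mem := valP y; rewrite /sphere_set /= => ->.
  by rewrite mul1r -exprVn sqrtr_sqr gtr0_norm // invr_gt0.
apply/val_inj/rowP => j; rewrite /= /to_row NE invr_eq0 (negbTE (T_neq0 y)) mxE ej.
by rewrite invrK divfK.
Qed.

Lemma to_sphere_base x : val x None = 1 -> to_sphere x = sphere_pole R (d i).
Proof.
move=> x1; rewrite -(of_sphereK (sphere_pole R (d i))); congr (to_sphere _).
apply: realization_eq => v; rewrite of_sphere_pole.
case: (eqVneq v None) => [->//|vN].
have := realization_sum x; rewrite (bigD1 None) //= x1 => /eqP.
rewrite -subr_eq0 addrAC subrr add0r psumr_eq0 => [|w _]; last exact: realization_ge0.
by move=> /allP/(_ v (mem_index_enum _)); rewrite vN => /eqP.
Qed.

End StdSphere.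

(** A point in two lobes is the base vertex, which goes to the poles identified in the wedge. So [F]
    does not depend on the lobe chosen by [index], and the lobes form a finite closed cover. The
    index [i0] provides a lobe for the base vertex and the default of the choice. *)
Lemma std_wedge_homotopy_equivalent (R : realType) (I : finType) (d : I -> nat) (i0 : I) :
  homotopy_equivalent R (realization R (std d)) (wedge (fun i => sphere_pole R (d i))).
Proof.
pose X := realization R (std d); pose p i := sphere_pole R (d i).
pose index (x : X) : I :=
  odflt i0 [pick i | [forall v, (v \in lobe d i) || (val x v == 0)]].
pose F (x : X) : wedge p := wedge_lift p (to_sphere (index x) x).
have in_lobeP i (x : X) :
    reflect (in_lobe i x) [forall v, (v \in lobe d i) || (val x v == 0)].
  apply: (iffP forallP) => h v; have := h v; first by move=> /orP[->|/eqP].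
  by case: (v \in lobe d i) => //= ->.
have cover (x : X) : exists i, in_lobe i x.
  have := realization_supp x; rewrite inE => /orP[h|/existsP[i h]].
    exists i0 => v vi; have := fintype.subsetP h v; rewrite !inE.
    by case: (eqVneq (val x v) 0) => // _ /(_ isT)/eqP vN; rewrite vN inE in vi.
  exists i => v vi; have := fintype.subsetP (proper_sub h) v; rewrite inE (negbTE vi).
  by case: (eqVneq (val x v) 0) => // _ /(_ isT).
have FE i (x : X) : in_lobe i x -> F x = wedge_lift p (to_sphere i x).
  move=> xi; have xk : in_lobe (index x) x.
    rewrite /index; case: pickP => [k /in_lobeP//|h].
    by move/in_lobeP : xi; rewrite h.
  have [ki|ki] := eqVneq (index x) i; first by rewrite /F ki.
  have x1 : val x None = 1.
    rewrite -(realization_sum x) (bigD1 None) //= big1 ?addr0 // => -[v|] // _.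
    have [vi|vi] := eqVneq (tag v) i; last by apply: xi; rewrite inE.
    by apply: xk; rewrite inE vi eq_sym.
  by rewrite /F !to_sphere_base // (wedge_liftE p (p i) (p (index x))).
have inj i j : of_sphere (p i) = of_sphere (p j) :> X.
  by apply: realization_eq => v; rewrite !of_sphere_pole.
pose G : wedge p -> X := wedge_fun (fun i => @of_sphere R I d i).
apply: (@homeomorphic_homotopy_equivalent _ _ _ F G).
- apply: (@closed_cover_continuous _ _ _ (fun i => @in_lobe R I d i) _
    (fun i x => wedge_lift p (to_sphere i x))) => //.
  + by move=> i; exact: closed_in_lobe.
  move=> i x xi; apply: (continuous_comp (to_sphere_continuous_at xi)).
  exact: wedge_lift_continuous.
- by apply: wedge_fun_continuous => // i; exact: of_sphere_continuous.
- move=> x; have [i xi] := cover x.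
  by rewrite (FE i x xi) /G wedge_lift_funE // to_sphereK.
move=> z; have : [set: wedge p] z by [].
rewrite -wedgeTE => -[i _ [y _ <-]].
by rewrite /G wedge_lift_funE // (FE i) ?of_sphereK //; exact: of_sphere_in_lobe.
Qed.

Lemma std_point_homotopy_equivalent (R : realType) (I : finType) (d : I -> nat) :
  #|I| = 0%N -> homotopy_equivalent R (realization R (std d)) (one_point R).
Proof.
move=> I0; have noI (i : I) : False.
  by have := max_card (pred1 i); rewrite I0 card1.
have onlyN (v : std_vertex d) : v = None by case: v => // -[i]; case: (noI i).
have xP : realization_set (std d) (fun _ : std_vertex d => 1 : R).
  split=> [v||]; first exact: ler01.
    by rewrite (bigD1 None) //= big1 ?addr0 // => v; rewrite (onlyN v).
  by rewrite inE; apply/orP; left; apply/fintype.subsetP=> v _; rewrite inE (onlyN v).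
pose x0 : realization R (std d) := exist _ (fun=> 1) (mem_set xP).
pose o : one_point R := exist _ 0 (mem_set (erefl (0 : R))).
apply: (@homeomorphic_homotopy_equivalent _ _ _ (fun=> o) (fun=> x0)).
- by move=> x B /nbhs_singleton Bo; apply: (filterS _ (@filterT _ (nbhs x) _)) => y _.
- by move=> x B /nbhs_singleton Bo; apply: (filterS _ (@filterT _ (nbhs x) _)) => y _.
- move=> x; apply: realization_eq => v /=; rewrite (onlyN v).
  rewrite -(realization_sum x) (bigD1 None) //= big1 ?addr0 // => w.
  by rewrite (onlyN w).
by case=> y yP; apply: val_inj => /=; have /set_mem := yP.
Qed.

Lemma std_reindex_homotopy_equivalent (R : realType) (I J : finType) (d : I -> nat) (h : J -> I) :
  bijective h ->
  homotopy_equivalent R (realization R (std (d \o h))) (realization R (std d)).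
Proof.
case=> h' hK h'K.
pose f (v : std_vertex (d \o h)) : std_vertex d :=
  if v is Some w then Some (@Tagged _ (h (tag w)) (fun i => 'I_(d i).+1) (tagged w)) else None.
have f_inj : injective f.
  move=> [[j a]|] [[j' a']|] //= [] /(can_inj hK) jj'; subst j' => /= E.
  congr (Some _); apply: eq_existT_uncurried; exists erefl => /=.
  by move/eqP : E; rewrite eq_Tagged => /eqP.
have f_surj v : exists w, f w = v.
  case: v => [[i a]|]; last by exists None.
  rewrite -(h'K i) in a *; exists (Some (@Tagged _ (h' i) (fun j => 'I_(d (h j)).+1) a)).
  by [].
suff <- : [set (f @: s)%SET | s : {set _} in std (d \o h)]%SET = std d.
  exact: rename_homotopy_equivalent.
apply/setP=> t; rewrite mem_imset_complex //.
have -> /= : t \subset (f @: [set: std_vertex (d \o h)])%SET.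
  by apply/fintype.subsetP=> v _; have [w <-] := f_surj v; exact: imset_f.
have lobeE w j : (f w \in lobe d (h j)) = (w \in lobe (d \o h) j).
  by case: w => [w|]; rewrite !inE //= (inj_eq (can_inj hK)).
have NE w : (f w == None) = (w == None) by case: w.
rewrite [in LHS]inE [in RHS]inE; congr (_ || _).
  apply/fintype.subsetP/fintype.subsetP => H v vt.
    by have [w wv] := f_surj v; rewrite -wv inE NE; have := H w; rewrite !inE wv; exact.
  by have := H (f v); rewrite !inE NE; apply; rewrite !inE in vt.
apply/existsP/existsP => -[k /properP[/fintype.subsetP H1 [v vk vt]]].
  exists (h k); apply/properP; split.
    apply/fintype.subsetP=> w wt; have [w' wE] := f_surj w.
    by rewrite -wE lobeE; apply: H1; rewrite inE wE.
  by exists (f v); [rewrite lobeE|rewrite inE in vt].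
exists (h' k); apply/properP; split.
  by apply/fintype.subsetP=> w; rewrite inE => /H1; rewrite -lobeE h'K.
have [w wE] := f_surj v; exists w; first by rewrite -lobeE h'K wE.
by rewrite inE wE.
Qed.

Lemma std_he_wedge_of_spheres (R : realType) (I : finType) (d : I -> nat) :
  he_wedge_of_spheres R (realization R (std d)).
Proof.
case E : #|I| => [|n]; first by left; exact: std_point_homotopy_equivalent.
right; exists n, (fun k => d (enum_val (cast_ord (esym E) k))).
have bij : bijective (fun k => enum_val (cast_ord (esym E) k)).
  exists (fun i => cast_ord E (enum_rank i)) => k.
    by rewrite enum_valK cast_ordKV.
  by rewrite cast_ordK enum_rankK.
apply: homotopy_equivalent_trans (std_wedge_homotopy_equivalent R _ 0).
exact/homotopy_equivalent_sym/(std_reindex_homotopy_equivalent _ d bij).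
Qed.

Lemma he_wedge_of_spheres_std (R : realType) (X : topologicalType) :
  he_wedge_of_spheres R X -> exists (I : finType) (d : I -> nat),
    homotopy_equivalent R X (realization R (std d)).
Proof.
case=> [h|[n [d h]]].
  exists void, (fun=> 0%N); apply: homotopy_equivalent_trans h _.
  by apply/homotopy_equivalent_sym/std_point_homotopy_equivalent; rewrite card_void.
exists 'I_n.+1, d; apply: homotopy_equivalent_trans h _.
exact/homotopy_equivalent_sym/(std_wedge_homotopy_equivalent R d ord0).
Qed.

Lemma he_wedge_of_spheres_homotopy_equivalent (R : realType) (X Y : topologicalType) :
  homotopy_equivalent R X Y -> he_wedge_of_spheres R Y -> he_wedge_of_spheres R X.
Proof.
move=> XY [YZ|[n [d YZ]]]; [left|right; exists n, d];
  exact: homotopy_equivalent_trans XY YZ.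
Qed.

Lemma std_realization (R : realType) (I : finType) (d : I -> nat) :
  exists x : realization R (std d), val x None = 1.
Proof.
have xP : realization_set (std d) (fun v : std_vertex d => (v == None)%:R : R).
  split=> [v||]; first exact: ler0n.
    by rewrite (bigD1 None) //= big1 ?addr0 // => v /negbTE ->.
  rewrite inE; apply/orP; left; apply/fintype.subsetP=> v; rewrite !inE.
  by case: (v == None) => //; rewrite eqxx.
by exists (exist _ (fun v => (v == None)%:R) (mem_set xP)).
Qed.

(** * The lexicographic product as a polyhedral join, and the theorem *)

Lemma indep_complex_lex_product (G H : graph) :
  indep_complex (lex_product G H) =
  indep_join (@adj G) (indep_complex H) [set: G]%SET.
Proof.
apply/setP=> t; rewrite !inE.
have -> /= : t \subset lying_over H [set: G]%SET.
  by apply/fintype.subsetP=> x _; rewrite !inE.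
apply/forall_inP/andP => [h|[/forall_inP h1 /forallP h2] x xt].
  split.
    apply/forall_inP=> x xt; apply/forall_inP=> y yt.
    by have := forall_inP (h x xt) y yt; rewrite negb_or => /andP[].
  apply/forallP=> w; rewrite inE; apply/forall_inP=> a; rewrite inE => at_.
  apply/forall_inP=> b; rewrite inE => bt.
  by have := forall_inP (h _ at_) _ bt; rewrite /= negb_or /= eqxx => /andP[].
apply/forall_inP=> y yt; rewrite negb_or; apply/andP; split.
  exact: (forall_inP (h1 x xt)).
have [xy|//] := eqVneq x.1 y.1.
have := h2 x.1; rewrite inE => /forall_inP/(_ x.2).
rewrite inE -surjective_pairing => /(_ xt)/forall_inP/(_ y.2); apply.
by rewrite inE xy -surjective_pairing.
Qed.

Theorem theorem1p2 (R : realType) (G H : graph)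
    (G_nonempty : (0 < #|G|)%N)
    (G_forest : forest G)
    (G_no_dominating :
      ~ exists u : G, forall v : G, v != u -> adj u v)
    (H_wedge : he_wedge_of_spheres R (realization R (indep_complex H))) :
  he_wedge_of_spheres R (realization R (indep_complex (lex_product G H))).
Proof.
have [I [d Hd]] := he_wedge_of_spheres_std H_wedge.
have K0 : finset.set0 \in indep_complex H.
  by rewrite inE; apply/forall_inP=> x; rewrite inE.
have L0 : finset.set0 \in std d by rewrite inE finset.sub0set.
have LN : [set None]%SET \in std d by rewrite inE subxx.
(* Being homotopy equivalent to a nonempty space, [|I(H)|] has a point [k0], which serves as default
   for fibers of weight zero. *)
have [x0 _] := std_realization R d; have [_ [g _]] := Hd; pose k0 := g x0.
rewrite indep_complex_lex_product.
apply: he_wedge_of_spheres_homotopy_equivalent.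
  exact: (indep_join_homotopy_equivalent (@adj G) K0 L0 k0 Hd).
(* Otherwise all degrees in the subgraph induced on [U] are at least 2, and [induced_cycle] gives a
   full cycle in [G]. *)
have degenerate (U : {set G}) : U != finset.set0 ->
    exists2 v, v \in U & (#|[set w in U | adj v w]%SET| <= 1)%N.
  move=> U0; apply: contrapT => nodeg.
  have [|n [f f_inj fE]] := induced_cycle (@adj_sym G) (@adj_irr G) U0.
    by move=> v vU; rewrite ltnNge; apply/negP=> h; apply: nodeg; exists v.
  by apply: (G_forest n); exists f.
have nodom (u : G) : exists2 v, v != u & ~~ adj u v.
  apply: contrapT => h; apply: G_no_dominating; exists u => v vu.
  by apply/negPn/negP=> uv; apply: h; exists v.
have [p [J [d' /(simple_equiv_homotopy_equivalent R) Jd]]] :=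
  wedgelike_indep_join (@adj_sym G) (@adj_irr G) (@complex_std I d) L0 LN (@std_apex I d)
    degenerate G_nonempty nodom.
exact: he_wedge_of_spheres_homotopy_equivalent Jd (std_he_wedge_of_spheres R d').
Qed.
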